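(* The isomorphism classes of pairs $(S,f)$, where $S$ is a $3$-dimensional quantum polynomial algebra determined by a symmetric regular superpotential of Type S, Type S$'$ or Type NC (so $S$ is isomorphic to $\mathcal{S}$, $\mathcal{S}'$ or $\mathcal{N}$) and $f\in S_2$ is a central regular element, are given by the following list, in which $\alpha,\beta\in k^\times$: Type S: $(\mathcal{S},x^2)$, $(\mathcal{S},x^2+y^2)$, $(\mathcal{S},x^2+y^2+z^2)$. Type S$'$: $(\mathcal{S}',x^2)$, $(\mathcal{S}',y^2)$, $(\mathcal{S}',x^2+y^2)$, $(\mathcal{S}',y^2+z^2)$, $(\mathcal{S}',\alpha x^2+y^2+z^2)$. Type NC: $(\mathcal{N},x^2)$, $(\mathcal{N},z^2)$, $(\mathcal{N},\alpha x^2+y^2)$, $(\mathcal{N},\alpha x^2+z^2)$, $(\mathcal{N},\alpha x^2+\beta y^2+z^2)$. That is, every such pair is isomorphic to a pair in the list, and pairs belonging to different entries of the list are not isomorphic. Moreover, within the parametrized entries, for $\alpha,\alpha',\beta,\beta'\in k^\times$: (1) $(\mathcal{S}',\alpha x^2+y^2+z^2)\cong(\mathcal{S}',\alpha'x^2+y^2+z^2)$ if and only if $\alpha'^2=\alpha^2$; (2) $(\mathcal{N},\alpha x^2+y^2)\cong(\mathcal{N},\alpha'x^2+y^2)$ if and only if $\alpha'^3=\alpha^{\pm3}$ (i.e. $\alpha'^3=\alpha^3$ or $\alpha'^3=\alpha^{-3}$); (3) $(\mathcal{N},\alpha x^2+z^2)\cong(\mathcal{N},\alpha'x^2+z^2)$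 if and only if $\alpha'^3=\alpha^3$; (4) $(\mathcal{N},\alpha x^2+\beta y^2+z^2)\cong(\mathcal{N},\alpha'x^2+\beta'y^2+z^2)$ if and only if $(\alpha'^3,\beta'^3,\alpha'\beta')=(\alpha^3,\beta^3,\alpha\beta)$ or $(\alpha'^3,\beta'^3,\alpha'\beta')=(\beta^3,\alpha^3,\alpha\beta)$.
   Context: Let $k$ be an algebraically closed field of characteristic zero and $k^\times=k\setminus\{0\}$. With $x,y,z$ in degree $1$, put $$\mathcal{S}=k\langle x,y,z\rangle/(xy+yx,\ yz+zy,\ zx+xz),$$ $$\mathcal{S}'=k\langle x,y,z\rangle/(xy+yx,\ yz+zy+x^2,\ zx+xz),$$ $$\mathcal{N}=k\langle x,y,z\rangle/(xy+yx,\ yz+zy+x^2,\ zx+xz+y^2).$$ These are $3$-dimensional quantum polynomial algebras: noetherian connected graded algebras of global dimension $3$ with $\operatorname{Ext}^i(k,S)\cong k$ for $i=3$ and $0$ otherwise, and Hilbert series $(1-t)^{-3}$. They are the derivation-quotient algebras of the symmetric regular superpotentials of Type S, $\omega_S=xyz+yzx+zxy+xzy+zyx+yxz$; Type S$'$, $\omega_S+x^3$; and Type NC, $\omega_S+x^3+y^3$. Here the derivation-quotient algebra of $\omega=x\otimes\omega_x+y\otimes\omega_y+z\otimes\omega_z$ is $k\langle x,y,z\rangle/(\omega_x,\omega_y,\omega_z)$. Two pairs $(S,f)$, $(S',f')$, with $f\in S_2$, $f'\in S'_2$ central regular, are isomorphic if there is an isomorphism of graded algebras $\varphi:S\to S'$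 with $\varphi(f)=f'$. *)

(* Defs.v *)
From HB Require Import structures.
From mathcomp Require Import all_boot all_order all_algebra ring_quotient finmap.
From mathcomp Require Import boolp.
From mathcomp Require Import monalg.

Set Implicit Arguments.
Unset Strict Implicit.
Unset Printing Implicit Defensive.

Import GRing.Theory.
Local Open Scope ring_scope.
Local Open Scope quotient_scope.

Record is_grading (k : fieldType) (A : algType k) (G : nat -> A -> Prop) : Prop :=
  IsGrading {
    grading0 : forall n, G n 0;
    gradingD : forall n a b, G n a -> G n b -> G n (a + b);
    gradingZ : forall n c a, G n a -> G n (c *: a);
    grading1 : G 0%N 1;
    gradingM : forall m n a b, G m a -> G n b -> G (m + n)%N (a * b);
    grading_span : forall a, exists N (c : nat -> A),
      (forall n, G n (c n)) /\ a = \sum_(n < N) c n;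
    grading_free : forall N (c : nat -> A), (forall n, G n (c n)) ->
      \sum_(n < N) c n = 0 -> forall n, (n < N)%N -> c n = 0
  }.

Record gradedAlg (k : fieldType) := GradedAlg {
  galg :> algType k;
  gcomp : nat -> galg -> Prop;
  gcompP : is_grading gcomp
}.

Definition graded_iso (k : fieldType) (A B : gradedAlg k)
    (phi : {lrmorphism A -> B}) : Prop :=
  bijective phi /\ forall n a, gcomp n a <-> gcomp n (phi a).

Definition graded_isomorphic (k : fieldType) (A B : gradedAlg k) : Prop :=
  exists phi : {lrmorphism A -> B}, graded_iso phi.

Definition central (A : nzRingType) (f : A) : Prop := forall a, f * a = a * f.

Definition regular_elt (A : nzRingType) (f : A) : Prop :=
  forall a, (f * a = 0 -> a = 0) /\ (a * f = 0 -> a = 0).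

Record algPair (k : fieldType) := AlgPair {
  pair_alg : gradedAlg k;
  pair_elt : pair_alg
}.

Definition pair_iso (k : fieldType) (P Q : algPair k) : Prop :=
  exists2 phi : {lrmorphism pair_alg P -> pair_alg Q},
    graded_iso phi & phi (pair_elt P) = pair_elt Q.

(* A transparent copy of [seq 'I_3] is used instead of [{fmonom 'I_3}] because
   rewriting in [{malg k[{fmonom _}]}] is extremely slow. *)
Definition word : Type := seq 'I_3.
HB.instance Definition _ := Choice.on word.

Fact word_unitm (s t : word) : s ++ t = [::] -> s = [::] /\ t = [::].
Proof. by case: s t => [|? ?] [|? ?]. Qed.

HB.instance Definition _ := @Choice_isMonomialDef.Build word [::] cat
  (@catA _) (@cat0s _) (@cats0 _) word_unitm.

Notation freeAlg k := {malg k[word]}.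

Lemma mul3_sum (A : nzRingType) (I J : Type) (s : seq I) (t : seq J) F G (r : A) :
  (\sum_(i <- s) F i) * r * (\sum_(j <- t) G j)
  = \sum_(i <- s) \sum_(j <- t) F i * r * G j.
Proof. by rewrite !mulr_suml; apply: eq_bigr => i _; rewrite mulr_sumr. Qed.

Lemma mulBB (A : nzRingType) (a b p q : A) :
  a * b - p * q = a * (b - q) + (a - p) * q.
Proof. by rewrite mulrBr mulrBl addrA addrNK. Qed.

Section FreeAlgebra.
Variable k : fieldType.

Local Notation freeAlg := (freeAlg k).

Definition fgen (i : 'I_3) : freeAlg := << ([:: i] : word) >>.

Definition homog (d : nat) (p : freeAlg) : Prop :=
  forall m, p@_m != 0 -> size m = d.

Definition ideal_gen (R : seq freeAlg) (p : freeAlg) : Prop :=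
  exists2 s : seq (freeAlg * freeAlg * freeAlg),
    forall t, t \in s -> t.1.2 \in R
    & p = \sum_(t <- s) t.1.1 * t.1.2 * t.2.

Lemma homog0 d : homog d 0.
Proof. by move=> m; rewrite mcoeff0 eqxx. Qed.

Lemma homogD d p q : homog d p -> homog d q -> homog d (p + q).
Proof.
move=> hp hq m; rewrite mcoeffD.
have [->|/hp //] := eqVneq p@_m 0; rewrite add0r; exact: hq.
Qed.

Lemma homogZ d c p : homog d p -> homog d (c *: p).
Proof.
by move=> hp m; rewrite mcoeffZ => h; apply: hp; apply: contra_neq h => ->; rewrite mulr0.
Qed.

Lemma homogM d e p q : homog d p -> homog e q -> homog (d + e) (p * q).
Proof.
move=> hp hq m; rewrite mcoeff_neq0 => /msuppM_le[m1 [m2 []]].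
rewrite -!mcoeff_neq0 => /hp <- /hq <- ->; exact: size_cat.
Qed.

Lemma homogU c (m : word) : homog (size m) (<< c *g m >>).
Proof. by move=> m'; rewrite mcoeffU; case: (m =P m') => [->//|]; rewrite mulr0n eqxx. Qed.

Lemma homog1 : homog 0 1.
Proof. by move=> m; rewrite mcoeff1; case: (m =P mone) => [->|]; rewrite ?eqxx. Qed.

Lemma homog_gen i : homog 1 (fgen i).
Proof. exact: (@homogU 1 ([:: i] : word)). Qed.

Lemma homog_sum d (I : Type) (r : seq I) (P : pred I) (F : I -> freeAlg) :
  (forall i, P i -> homog d (F i)) -> homog d (\sum_(i <- r | P i) F i).
Proof.
by move=> h; apply: (big_ind (homog d)) => //; [exact: homog0|exact: homogD].
Qed.

Lemma malg_scaleAr c (p q : freeAlg) : c *: (p * q) = p * (c *: q).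
Proof.
apply/malgP => m; rewrite mcoeffZ mcoeffMl.
rewrite (mcoeffMlw _ (fsubset_refl _) (msuppZ_le c q)) mulr_sumr.
apply: eq_bigr => m1 _; rewrite mulr_sumr; apply: eq_bigr => m2 _.
by rewrite mcoeffZ mulrnAr; congr (_ *+ _); rewrite mulrCA.
Qed.

Definition hproj (d : nat) (p : freeAlg) : freeAlg :=
  \sum_(m <- msupp p | size m == d) << p@_m *g m >>.

Lemma hprojE d p m : (hproj d p)@_m = if size m == d then p@_m else 0.
Proof.
rewrite /hproj raddf_sum /=; under eq_bigr do rewrite mcoeffU.
have [mp|/mcoeff_outdom p0] := boolP (m \in msupp p); last first.
  rewrite p0 if_same big1 // => m' _.
  by case: eqP => [->|]; rewrite ?p0 ?mul0rn ?mulr0n.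
case: (boolP (size m == d)) => hm.
  rewrite big_mkcond (bigD1_seq m) ?fset_uniq //= hm eqxx mulr1n big1 ?addr0 // => m' ne.
  by rewrite (negbTE ne) mulr0n if_same.
apply: big1 => m' hm'; case: eqP => [e|]; last by rewrite mulr0n.
by rewrite e (negbTE hm) in hm'.
Qed.

Lemma hprojD d p q : hproj d (p + q) = hproj d p + hproj d q.
Proof.
by apply/malgP => m; rewrite mcoeffD !hprojE; case: ifP => _; rewrite ?mcoeffD ?add0r.
Qed.

Lemma hproj0 d : hproj d 0 = 0.
Proof. by rewrite /hproj msupp0 big_mkcond big_seq_fset0. Qed.

Lemma hproj_sum d (I : Type) (r : seq I) (F : I -> freeAlg) :
  hproj d (\sum_(i <- r) F i) = \sum_(i <- r) hproj d (F i).
Proof. exact: (big_morph _ (hprojD d) (hproj0 d)). Qed.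

Lemma homog_hproj d p : homog d (hproj d p).
Proof. by move=> m; rewrite hprojE; case: (size m =P d) => //; rewrite eqxx. Qed.

Lemma hproj_homog d e p : homog e p -> hproj d p = if e == d then p else 0.
Proof.
move=> hp; apply/malgP => m; rewrite hprojE.
have [e0|/hp <-] := eqVneq p@_m 0; last by case: ifP; rewrite ?mcoeff0.
by case: ifP; case: ifP; rewrite ?mcoeff0 ?e0.
Qed.

Lemma hproj_total p : exists N, p = \sum_(d < N) hproj d p.
Proof.
exists (\max_(m <- msupp p) size m).+1; apply/malgP => m.
rewrite raddf_sum /=; under eq_bigr do rewrite hprojE.
have [mp|/mcoeff_outdom ->] := boolP (m \in msupp p); last first.
  by rewrite big1 // => i _; rewrite if_same.
have lt : (size m < (\max_(m <- msupp p) size m).+1)%N.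
  by rewrite ltnS; exact: leq_bigmax_seq.
rewrite (bigD1 (Ordinal lt)) //= eqxx big1 ?addr0 // => i ne.
by case: eqP => // e; case/eqP: ne; apply: val_inj.
Qed.

Section Ideal.
Variable R : seq freeAlg.

Lemma ideal_gen0 : ideal_gen R 0.
Proof. by exists [::]; rewrite // big_nil. Qed.

Lemma ideal_genD p q : ideal_gen R p -> ideal_gen R q -> ideal_gen R (p + q).
Proof.
move=> [s hs ->] [t ht ->]; exists (s ++ t); last by rewrite big_cat.
by move=> u; rewrite mem_cat => /orP[/hs|/ht].
Qed.

Lemma ideal_genMl a p : ideal_gen R p -> ideal_gen R (a * p).
Proof.
move=> [s hs ->]; exists [seq (a * t.1.1, t.1.2, t.2) | t <- s].
  by move=> _ /mapP[t ts ->] /=; exact: hs.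
by rewrite big_map mulr_sumr; apply: eq_bigr => t _; rewrite !mulrA.
Qed.

Lemma ideal_genMr a p : ideal_gen R p -> ideal_gen R (p * a).
Proof.
move=> [s hs ->]; exists [seq (t.1.1, t.1.2, t.2 * a) | t <- s].
  by move=> _ /mapP[t ts ->] /=; exact: hs.
by rewrite big_map mulr_suml; apply: eq_bigr => t _; rewrite !mulrA.
Qed.

Lemma ideal_gen_mem r : r \in R -> ideal_gen R r.
Proof.
move=> hr; exists [:: (1, r, 1)]; last by rewrite big_seq1 /= mul1r mulr1.
by move=> t; rewrite inE => /eqP ->.
Qed.

Lemma ideal_genN p : ideal_gen R p -> ideal_gen R (- p).
Proof. by rewrite -mulN1r; exact: ideal_genMl. Qed.

Lemma ideal_gen_sum (I : eqType) (r : seq I) (F : I -> freeAlg) :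
  (forall i, i \in r -> ideal_gen R (F i)) -> ideal_gen R (\sum_(i <- r) F i).
Proof.
move=> h; rewrite big_seq; apply: (big_ind (ideal_gen R)) => //.
- exact: ideal_gen0.
- exact: ideal_genD.
Qed.

Lemma ideal_gen_hproj e d p : (forall r, r \in R -> homog e r) ->
  ideal_gen R p -> ideal_gen R (hproj d p).
Proof.
move=> hR [s hs ->]; rewrite hproj_sum; apply: ideal_gen_sum => -[[a r] b] /hs /= rR.
have -> : a * r * b = \sum_(m <- msupp a) \sum_(m' <- msupp b)
    << a@_m *g m >> * r * << b@_m' *g m' >> by rewrite -mul3_sum -!monalgE.
rewrite hproj_sum; apply: ideal_gen_sum => m _.
rewrite hproj_sum; apply: ideal_gen_sum => m' _.
rewrite (hproj_homog _ (homogM (homogM (@homogU _ _) (hR _ rR)) (@homogU _ _))).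
case: ifP => _; last exact: ideal_gen0.
by apply: ideal_genMr; apply: ideal_genMl; exact: ideal_gen_mem.
Qed.

Lemma ideal_gen1 e : (forall r, r \in R -> homog e.+1 r) -> ~ ideal_gen R 1.
Proof.
move=> hR [s hs /(congr1 (mcoeff (mone : word)))].
rewrite mcoeff1 eqxx raddf_sum /= big_seq big1 => [/eqP|t /hs tR].
  by rewrite oner_eq0.
rewrite !rmorphM /=; case: (eqVneq t.1.2@_(mone : word) 0) => [->|].
  by rewrite mulr0 mul0r.
by move=> /(hR _ tR).
Qed.

End Ideal.
End FreeAlgebra.

Record quadRel (k : fieldType) := QuadRel {
  qrels :> seq (freeAlg k);
  qrelsP : forall r, r \in qrels -> homog 2 r
}.

Section QuadraticAlgebra.
Variables (k : fieldType) (R : quadRel k).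

Definition qideal : {pred freeAlg k} := fun p => `[< ideal_gen R p >].

Lemma qidealP p : reflect (ideal_gen R p) (p \in qideal).
Proof. exact: asboolP. Qed.

Fact qideal_zmod_closed : zmod_closed qideal.
Proof.
split=> [|p q /qidealP hp /qidealP hq]; apply/qidealP; first exact: ideal_gen0.
by apply: ideal_genD => //; exact: ideal_genN.
Qed.
HB.instance Definition _ :=
  GRing.isZmodClosed.Build (freeAlg k) qideal qideal_zmod_closed.

Definition qalg : Type := Quotient.quot qideal.
HB.instance Definition _ := GRing.Zmodule.on qalg.
HB.instance Definition _ := EqQuotient.on qalg.

Definition qpi (p : freeAlg k) : qalg := \pi_qalg p.

Lemma qpi_eq p q : reflect (ideal_gen R (p - q)) (qpi p == qpi q).
Proof. by rewrite /qpi -(Quotient.idealrBE qideal); exact: qidealP. Qed.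

Lemma qpi_surj (a : qalg) : exists p, a = qpi p.
Proof. by exists (repr a); rewrite /qpi reprK. Qed.

Lemma qpiD p q : qpi (p + q) = qpi p + qpi q.
Proof. by rewrite /qpi Quotient.pi_add. Qed.

Lemma qpi0 : qpi 0 = 0.
Proof. by apply: (@addrI _ (qpi 0)); rewrite addr0 -qpiD addr0. Qed.

Lemma qpi0P p : reflect (ideal_gen R p) (qpi p == 0).
Proof. by rewrite -qpi0 -{1}[p]subr0; exact: qpi_eq. Qed.

Lemma qpi_repr p : ideal_gen R (repr (qpi p) - p).
Proof. by apply/qpi_eq; rewrite /qpi reprK. Qed.

Definition qone : qalg := qpi 1.
Definition qmul (a b : qalg) : qalg := qpi (repr a * repr b).
Definition qscale (c : k) (a : qalg) : qalg := qpi (c *: repr a).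

Lemma qpiM p q : qpi (p * q) = qmul (qpi p) (qpi q).
Proof.
apply/eqP; rewrite eq_sym; apply/qpi_eq; rewrite mulBB.
by apply: ideal_genD; [apply: ideal_genMl|apply: ideal_genMr]; exact: qpi_repr.
Qed.

Lemma qpiZ c p : qpi (c *: p) = qscale c (qpi p).
Proof.
apply/eqP; rewrite eq_sym; apply/qpi_eq; rewrite -scalerBr -mul_malgC.
by apply: ideal_genMl; exact: qpi_repr.
Qed.

Fact qmulA : associative qmul.
Proof.
move=> a b c; have [p ->] := qpi_surj a; have [q ->] := qpi_surj b.
by have [r ->] := qpi_surj c; rewrite -!qpiM mulrA.
Qed.

Fact qmul1l : left_id qone qmul.
Proof. by move=> a; have [p ->] := qpi_surj a; rewrite -qpiM mul1r. Qed.

Fact qmul1r : right_id qone qmul.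
Proof. by move=> a; have [p ->] := qpi_surj a; rewrite -qpiM mulr1. Qed.

Fact qmulDl : left_distributive qmul +%R.
Proof.
move=> a b c; have [p ->] := qpi_surj a; have [q ->] := qpi_surj b.
by have [r ->] := qpi_surj c; rewrite -qpiD -!qpiM mulrDl qpiD.
Qed.

Fact qmulDr : right_distributive qmul +%R.
Proof.
move=> a b c; have [p ->] := qpi_surj a; have [q ->] := qpi_surj b.
by have [r ->] := qpi_surj c; rewrite -qpiD -!qpiM mulrDr qpiD.
Qed.

Fact qone_neq0 : qone != 0.
Proof.
by apply/negP => /qpi0P; apply: (@ideal_gen1 _ _ 1); exact: qrelsP.
Qed.

HB.instance Definition _ := GRing.Zmodule_isNzRing.Build qalg
  qmulA qmul1l qmul1r qmulDl qmulDr qone_neq0.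

Fact qscaleA c d a : qscale c (qscale d a) = qscale (c * d) a.
Proof. by have [p ->] := qpi_surj a; rewrite -!qpiZ scalerA. Qed.

Fact qscale1 : left_id 1 qscale.
Proof. by move=> a; have [p ->] := qpi_surj a; rewrite -qpiZ scale1r. Qed.

Fact qscaleDr : right_distributive qscale +%R.
Proof.
move=> c a b; have [p ->] := qpi_surj a; have [q ->] := qpi_surj b.
by rewrite -qpiD -!qpiZ scalerDr qpiD.
Qed.

Fact qscaleDl a : {morph qscale^~ a : c d / c + d}.
Proof. by move=> c d; have [p ->] := qpi_surj a; rewrite -!qpiZ scalerDl qpiD. Qed.

HB.instance Definition _ := GRing.Zmodule_isLmodule.Build k qalg
  qscaleA qscale1 qscaleDr qscaleDl.

Fact qscaleAl c (a b : qalg) : c *: (a * b) = c *: a * b.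
Proof.
have [p ->] := qpi_surj a; have [q ->] := qpi_surj b.
by rewrite /GRing.scale /GRing.mul /= -!(qpiM, qpiZ) -scalerAl.
Qed.

HB.instance Definition _ := GRing.Lmodule_isLalgebra.Build k qalg qscaleAl.

Fact qscaleAr c (a b : qalg) : c *: (a * b) = a * (c *: b).
Proof.
have [p ->] := qpi_surj a; have [q ->] := qpi_surj b.
rewrite /GRing.scale /GRing.mul /= -!(qpiM, qpiZ); congr qpi.
exact: malg_scaleAr.
Qed.

HB.instance Definition _ := GRing.Lalgebra_isAlgebra.Build k qalg qscaleAr.

Fact qpi_is_zmod_morphism : zmod_morphism qpi.
Proof. by move=> p q; apply: (@addIr _ (qpi q)); rewrite -qpiD !addrNK. Qed.

Fact qpi_is_monoid_morphism : monoid_morphism qpi.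
Proof. by split=> // p q; exact: qpiM. Qed.

HB.instance Definition _ :=
  GRing.isZmodMorphism.Build (freeAlg k) qalg qpi qpi_is_zmod_morphism.
HB.instance Definition _ :=
  GRing.isMonoidMorphism.Build (freeAlg k) qalg qpi qpi_is_monoid_morphism.
HB.instance Definition _ :=
  GRing.isScalable.Build k (freeAlg k) qalg *:%R qpi qpiZ.

Definition qcomp (n : nat) (a : qalg) : Prop := exists2 p, homog n p & a = qpi p.

Fact qcomp_grading : is_grading qcomp.
Proof.
split=> [n|n _ _ [p hp ->] [q hq ->]|n c _ [p hp ->]||m n _ _ [p hp ->] [q hq ->]|a|].
- by exists 0; [exact: homog0|rewrite rmorph0].
- by exists (p + q); [exact: homogD|rewrite rmorphD].
- by exists (c *: p); [exact: homogZ|rewrite linearZ].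
- by exists 1; [exact: homog1|rewrite rmorph1].
- by exists (p * q); [exact: homogM|rewrite rmorphM].
- have [p ->] := qpi_surj a; have [N e] := hproj_total p.
  exists N, (fun n => qpi (hproj n p)); split; last by rewrite {1}e raddf_sum.
  by move=> n; exists (hproj n p); first exact: homog_hproj.
move=> N c hc c0 n ltnN.
have /choice[p pP] : forall n, exists p, homog n p /\ c n = qpi p.
  by move=> i; have [q ? ?] := hc i; exists q.
have {}c0 : ideal_gen R (\sum_(i < N) p i).
  apply/qpi0P; rewrite -[X in _ == X]c0 raddf_sum.
  by apply/eqP; apply: eq_bigr => i _; have [_ ->] := pP i.
have [_ ->] := pP n; apply/eqP/qpi0P.
have := ideal_gen_hproj n (@qrelsP _ R) c0; rewrite hproj_sum.
rewrite (bigD1 (Ordinal ltnN)) //= big1 => [|i ne].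
  by rewrite addr0 (hproj_homog _ (proj1 (pP n))) eqxx.
rewrite (hproj_homog _ (proj1 (pP i))); case: eqP => // e.
by case/eqP: ne; exact: val_inj.
Qed.

Definition qgalg : gradedAlg k := GradedAlg qcomp_grading.

End QuadraticAlgebra.

Section Types.
Variable k : fieldType.

Definition fx : freeAlg k := fgen k 0.
Definition fy : freeAlg k := fgen k 1.
Definition fz : freeAlg k := fgen k 2%:R.

Lemma homog_word2 i j : homog 2 (fgen k i * fgen k j).
Proof. exact: (homogM (@homog_gen k i) (@homog_gen k j)). Qed.

Lemma homog_word3 i j l : homog 3 (fgen k i * fgen k j * fgen k l).
Proof. exact: (homogM (@homog_word2 i j) (@homog_gen k l)). Qed.

Definition relS := [:: fx * fy + fy * fx; fy * fz + fz * fy; fz * fx + fx * fz].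
Definition relS' :=
  [:: fx * fy + fy * fx; fy * fz + fz * fy + fx ^+ 2; fz * fx + fx * fz].
Definition relNC :=
  [:: fx * fy + fy * fx; fy * fz + fz * fy + fx ^+ 2;
      fz * fx + fx * fz + fy ^+ 2].

Fact relSP r : r \in relS -> homog 2 r.
Proof.
rewrite !inE => /or3P[] /eqP ->.
- exact: (homogD (@homog_word2 0 1) (@homog_word2 1 0)).
- exact: (homogD (@homog_word2 1 2%:R) (@homog_word2 2%:R 1)).
- exact: (homogD (@homog_word2 2%:R 0) (@homog_word2 0 2%:R)).
Qed.

Fact relS'P r : r \in relS' -> homog 2 r.
Proof.
rewrite !inE => /or3P[] /eqP ->.
- exact: (homogD (@homog_word2 0 1) (@homog_word2 1 0)).
- exact: (homogD (homogD (@homog_word2 1 2%:R) (@homog_word2 2%:R 1)) (@homog_word2 0 0)).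
- exact: (homogD (@homog_word2 2%:R 0) (@homog_word2 0 2%:R)).
Qed.

Fact relNCP r : r \in relNC -> homog 2 r.
Proof.
rewrite !inE => /or3P[] /eqP ->.
- exact: (homogD (@homog_word2 0 1) (@homog_word2 1 0)).
- exact: (homogD (homogD (@homog_word2 1 2%:R) (@homog_word2 2%:R 1)) (@homog_word2 0 0)).
- exact: (homogD (homogD (@homog_word2 2%:R 0) (@homog_word2 0 2%:R)) (@homog_word2 1 1)).
Qed.

Definition algS := QuadRel relSP.
Definition algS' := QuadRel relS'P.
Definition algNC := QuadRel relNCP.

(* [lderiv i w] is the factor w_i in w = x (x) w_x + y (x) w_y + z (x) w_z. *)
Definition lderiv (i : 'I_3) (w : freeAlg k) : freeAlg k :=
  \sum_(m <- msupp w | ohead m == Some i) << w@_m *g (behead m : word) >>.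

Lemma lderivE i w (m : word) : (lderiv i w)@_m = w@_(i :: m : word).
Proof.
rewrite /lderiv raddf_sum /=; under eq_bigr do rewrite mcoeffU.
rewrite big_mkcond /=; have [wm|/mcoeff_outdom w0] := boolP ((i :: m : word) \in msupp w).
  rewrite (bigD1_seq (i :: m : word)) ?fset_uniq //= !eqxx mulr1n big1 ?addr0 //.
  move=> [|j m'] //= ne; case: eqP => // -[e]; case: eqP => // e'.
  by case/eqP: ne; rewrite e e'.
rewrite w0 big1 // => -[|j m'] //= _; case: eqP => // -[->].
by case: eqP => [->|]; rewrite ?w0 ?mul0rn.
Qed.

Lemma homog_lderiv d i w : homog d.+1 w -> homog d (lderiv i w).
Proof.
move=> hw; rewrite /lderiv big_seq_cond; apply: homog_sum => m /andP[].
rewrite -mcoeff_neq0 => /hw; case: m => //= j m [<-] _; exact: homogU.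
Qed.

Definition omegaS : freeAlg k :=
  fx * fy * fz + fy * fz * fx + fz * fx * fy
  + fx * fz * fy + fz * fy * fx + fy * fx * fz.
Definition omegaS' : freeAlg k := omegaS + fx ^+ 3.
Definition omegaNC : freeAlg k := omegaS + fx ^+ 3 + fy ^+ 3.

Record cubicPotential := CubicPotential {
  potential :> freeAlg k;
  potentialP : homog 3 potential
}.

Fact omegaSP : homog 3 omegaS.
Proof.
exact: (homogD (homogD (homogD (homogD (homogD (@homog_word3 0 1 2%:R)
  (@homog_word3 1 2%:R 0))
  (@homog_word3 2%:R 0 1))
  (@homog_word3 0 2%:R 1))
  (@homog_word3 2%:R 1 0))
  (@homog_word3 1 0 2%:R)).
Qed.

Fact omegaS'P : homog 3 omegaS'.
Proof.
by rewrite /omegaS' exprSr expr2; exact: (homogD omegaSP (@homog_word3 0 0 0)).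
Qed.

Fact omegaNCP : homog 3 omegaNC.
Proof.
by rewrite /omegaNC [fy ^+ 3]exprSr expr2; exact: (homogD omegaS'P (@homog_word3 1 1 1)).
Qed.

Definition potS := CubicPotential omegaSP.
Definition potS' := CubicPotential omegaS'P.
Definition potNC := CubicPotential omegaNCP.

Fact derivRelP (w : cubicPotential) r :
  r \in [:: lderiv 0 w; lderiv 1 w; lderiv 2%:R w] -> homog 2 r.
Proof.
rewrite !inE => h.
have hw i : homog 2 (lderiv i w) by apply: homog_lderiv; exact: potentialP.
by case/or3P: h => /eqP ->.
Qed.

Definition derivRel (w : cubicPotential) : quadRel k := QuadRel (@derivRelP w).

Definition derivation_quotient (w : cubicPotential) : gradedAlg k :=
  qgalg (derivRel w).

Definition of_type_S_S'_NC (A : gradedAlg k) : Prop :=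
  [\/ graded_isomorphic A (derivation_quotient potS),
      graded_isomorphic A (derivation_quotient potS')
    | graded_isomorphic A (derivation_quotient potNC)].

Definition central_regular_pair (P : algPair k) : Prop :=
  [/\ of_type_S_S'_NC (pair_alg P), gcomp 2 (pair_elt P),
      central (pair_elt P) & regular_elt (pair_elt P)].

Definition qpair (R : quadRel k)
    (f : qalg R -> qalg R -> qalg R -> qalg R) : algPair k :=
  @AlgPair k (qgalg R) (f (qpi R fx) (qpi R fy) (qpi R fz)).

End Types.

Inductive entry : Type :=
  | S_x | S_x_y | S_x_y_z
  | S'_x | S'_y | S'_x_y | S'_y_z | S'_ax_y_z
  | NC_x | NC_z | NC_ax_y | NC_ax_z | NC_ax_by_z.

(* The parameters a and b are ignored by the entries in which they do not
   occur. *)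
Definition entry_pair (k : fieldType) (e : entry) (a b : k) : algPair k :=
  match e with
  | S_x => qpair (R := algS k) (fun x y z => x ^+ 2)
  | S_x_y => qpair (R := algS k) (fun x y z => x ^+ 2 + y ^+ 2)
  | S_x_y_z => qpair (R := algS k) (fun x y z => x ^+ 2 + y ^+ 2 + z ^+ 2)
  | S'_x => qpair (R := algS' k) (fun x y z => x ^+ 2)
  | S'_y => qpair (R := algS' k) (fun x y z => y ^+ 2)
  | S'_x_y => qpair (R := algS' k) (fun x y z => x ^+ 2 + y ^+ 2)
  | S'_y_z => qpair (R := algS' k) (fun x y z => y ^+ 2 + z ^+ 2)
  | S'_ax_y_z => qpair (R := algS' k) (fun x y z => a *: x ^+ 2 + y ^+ 2 + z ^+ 2)
  | NC_x => qpair (R := algNC k) (fun x y z => x ^+ 2)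
  | NC_z => qpair (R := algNC k) (fun x y z => z ^+ 2)
  | NC_ax_y => qpair (R := algNC k) (fun x y z => a *: x ^+ 2 + y ^+ 2)
  | NC_ax_z => qpair (R := algNC k) (fun x y z => a *: x ^+ 2 + z ^+ 2)
  | NC_ax_by_z =>
      qpair (R := algNC k) (fun x y z => a *: x ^+ 2 + b *: y ^+ 2 + z ^+ 2)
  end.

(* Main.v *)
Require Import Defs.
From HB Require Import structures.
From mathcomp Require Import all_boot all_order all_algebra.
From mathcomp Require Import ring finmap monalg.
Import GRing.Theory.
Local Open Scope ring_scope.

Set Implicit Arguments.
Unset Strict Implicit.
Unset Printing Implicit Defensive.

(** Write [A_(eps, del)] for the algebra on [x, y, z] with relations
    [xy + yx = yz + zy + eps x^2 = zx + xz + del y^2 = 0].  The three algebras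
    are those with [(eps, del)] equal to [(0, 0)], [(1, 0)] and [(1, 1)], and the
    derivation-quotient algebras of the three potentials have the same relations.

    In [A_(eps, del)] the squares [x^2], [y^2], [z^2] are central, and the
    algebra is a free module over the polynomials in them, with basis the
    monomials [x^i y^j z^l] with [i, j, l <= 1].  To see this, left multiplication
    by the generators is written down on a free module of rank 8 over a
    polynomial ring [k[X, Y, Z]]: it satisfies the relations, so the algebra acts
    ([pbw_act]), and [a |-> a . 1] is injective because it is undone by the
    evident map [pbw_sum] back to the algebra ([coordK]).  A combination
    [p x^2 + q y^2 + r z^2] acts as the scalar [pX + qY + rZ], so it is regular
    unless it vanishes; computing in the basis shows that these combinations are
    the only central elements of degree 2.  All that is needed in low degree is
    collected in [presentation], and holds by [qalg_presentation].

    A graded isomorphism is given by an invertible matrix, whose rows are the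
    linear forms [l] that are the images of the generators.  The anticommutator of two
    linear forms is a combination of the three squares ([lin_anticomm]), so the
    relations become quadratic equations in the entries ([rel_matrix]), and the
    square [l^2] gives the action on [(p, q, r)].  Solving the equations
    shows that the three algebras are pairwise non-isomorphic, and that up to
    a permutation of the generators all isomorphisms are diagonal
    (the lemmas [rel_matrix_*]).  For [(1, 0)] they are
    [(a, b, c)] with [a^2 = bc], up to exchanging [y] and [z]; for [(1, 1)] they
    satisfy [a^2 = bc] and [b^2 = ac], up to exchanging [x] and [y].  Conversely
    these diagonal maps and exchanges are isomorphisms, and with square roots
    in [k] they bring every nonzero [(p, q, r)] to an entry of the list, the
    remaining freedom being cube roots of unity and signs. *)

(** * Morphisms out of a quadratic algebra *)

Lemma ord3P (i : 'I_3) : [\/ i = 0, i = 1 | i = 2%:R].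
Proof.
case: i => [[|[|[|//]]] lt]; [apply: Or31|apply: Or32|apply: Or33];
  exact: val_inj.
Qed.

Section FreeEvaluation.
Variables (k : fieldType) (B : algType k) (g : 'I_3 -> B).

(** Value of a word when the letter [i] is replaced with [g i]. *)
Definition word_eval (m : word) : B := \prod_(i <- m) g i.

Fact word_eval_mmorphism : mmorphism word_eval.
Proof. by split=> [s t|]; rewrite /word_eval ?big_cat ?big_nil. Qed.
HB.instance Definition _ := isMultiplicative.Build word B word_eval word_eval_mmorphism.

(** The algebra morphism out of the free algebra that sends the generator [i]
    to [g i]. *)
Definition free_eval (p : freeAlg k) : B := mmap (in_alg B) word_eval p.

Fact free_eval_zmod_morphism : zmod_morphism free_eval.
Proof. exact: mmap_is_additive. Qed.

Fact free_eval_monoid_morphism : monoid_morphism free_eval.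
Proof.
have [M o] := @commr_mmap_is_multiplicative word k B (in_alg B) word_eval
  (fun _ _ _ => commr_sym (in_alg_comm _ _)).
by split.
Qed.

Fact free_evalZ c p : free_eval (c *: p) = c *: free_eval p.
Proof. by rewrite /free_eval mmapZ mulr_algl. Qed.

HB.instance Definition _ :=
  GRing.isZmodMorphism.Build (freeAlg k) B free_eval free_eval_zmod_morphism.
HB.instance Definition _ :=
  GRing.isMonoidMorphism.Build (freeAlg k) B free_eval free_eval_monoid_morphism.
HB.instance Definition _ :=
  GRing.isScalable.Build k (freeAlg k) B *:%R free_eval free_evalZ.

Lemma free_evalD p q : free_eval (p + q) = free_eval p + free_eval q.
Proof. exact: raddfD. Qed.

Lemma free_evalM p q : free_eval (p * q) = free_eval p * free_eval q.
Proof. exact: rmorphM. Qed.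

Lemma free_eval_gen i : free_eval (fgen k i) = g i.
Proof. by rewrite /free_eval /fgen mmapU /= scale1r mul1r /word_eval big_seq1. Qed.

Lemma free_eval_fx : free_eval (fx k) = g 0. Proof. exact: free_eval_gen. Qed.
Lemma free_eval_fy : free_eval (fy k) = g 1. Proof. exact: free_eval_gen. Qed.
Lemma free_eval_fz : free_eval (fz k) = g 2%:R. Proof. exact: free_eval_gen. Qed.

End FreeEvaluation.

Section QuotientLift.
Variables (k : fieldType) (R : quadRel k) (B : algType k) (g : 'I_3 -> B).
Hypothesis gR : forall r, r \in qrels R -> free_eval g r = 0.

(** The morphism out of the quadratic algebra induced by an evaluation that
    kills its relations. *)
Definition qlift (a : qalg R) : B := free_eval g (repr a).

Lemma free_eval_ideal p : ideal_gen R p -> free_eval g p = 0.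
Proof.
move=> [s hs ->]; rewrite raddf_sum /= big_seq big1 // => t /hs tR.
by rewrite !rmorphM /= (gR tR) mulr0 mul0r.
Qed.

Lemma qlift_pi p : qlift (qpi R p) = free_eval g p.
Proof.
by apply/eqP; rewrite -subr_eq0 -raddfB; apply/eqP/free_eval_ideal/qpi_repr.
Qed.

Fact qlift_zmod_morphism : zmod_morphism qlift.
Proof.
move=> a b; have [p ->] := qpi_surj a; have [q ->] := qpi_surj b.
by rewrite -rmorphB !qlift_pi rmorphB.
Qed.

Fact qlift_monoid_morphism : monoid_morphism qlift.
Proof.
split; first by rewrite -(rmorph1 (qpi R)) qlift_pi rmorph1.
move=> a b; have [p ->] := qpi_surj a; have [q ->] := qpi_surj b.
by rewrite -rmorphM !qlift_pi rmorphM.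
Qed.

Fact qliftZ c a : qlift (c *: a) = c *: qlift a.
Proof. by have [p ->] := qpi_surj a; rewrite -linearZ !qlift_pi linearZ. Qed.

Lemma exists_qlift : exists phi : {lrmorphism qalg R -> B},
  forall i, phi (qpi R (fgen k i)) = g i.
Proof.
pose z := GRing.isZmodMorphism.Build (qalg R) B qlift qlift_zmod_morphism.
pose m := GRing.isMonoidMorphism.Build (qalg R) B qlift qlift_monoid_morphism.
pose s := GRing.isScalable.Build k (qalg R) B *:%R qlift qliftZ.
pose phi : {lrmorphism qalg R -> B} := HB.pack qlift z m s.
by exists phi => i; rewrite /= qlift_pi free_eval_gen.
Qed.

End QuotientLift.

Section GradedMorphisms.
Variable k : fieldType.

Lemma lrmorph_inverse (A B : algType k) (phi : {lrmorphism A -> B}) psi :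
  cancel phi psi -> cancel psi phi ->
  exists psi' : {lrmorphism B -> A}, psi' =1 psi.
Proof.
move=> K K'.
have psiB : zmod_morphism psi.
  by move=> a b; apply: (can_inj K); rewrite rmorphB /= !K'.
have psiM : monoid_morphism psi.
  by split=> [|a b]; apply: (can_inj K); rewrite ?rmorph1 ?rmorphM /= ?K'.
have psiZ c : {morph psi : a / c *: a >-> c *: a}.
  by move=> a; apply: (can_inj K); rewrite linearZ /= !K'.
pose z := GRing.isZmodMorphism.Build B A psi psiB.
pose m := GRing.isMonoidMorphism.Build B A psi psiM.
pose s := GRing.isScalable.Build k B A *:%R psi psiZ.
pose psi' : {lrmorphism B -> A} := HB.pack psi z m s.
by exists psi'.
Qed.

Lemma pair_iso_sym (P Q : algPair k) : pair_iso P Q -> pair_iso Q P.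
Proof.
case=> phi [[psi K K'] gr] e.
have [psi' E] := lrmorph_inverse K K'.
exists psi'; last by rewrite E -e K.
split; first by exists phi => a; rewrite E ?K ?K'.
by move=> n a; rewrite E (gr n (psi a)) K'.
Qed.

Lemma pair_iso_trans (P Q T : algPair k) :
  pair_iso P Q -> pair_iso Q T -> pair_iso P T.
Proof.
case=> phi [bphi gr] e [psi [bpsi gr'] e'].
exists (psi \o phi : {lrmorphism _ -> _}); last by rewrite /= e e'.
split; first exact: bij_comp.
by move=> n a; rewrite gr gr'.
Qed.

Lemma monalgU_word c (m : word) :
  << c *g m >> = c *: \prod_(i <- m) fgen k i.
Proof.
transitivity (c *: << m >> : freeAlg k).
  by apply/malgP => m'; rewrite mcoeffZ !mcoeffU mulr_natr.
congr (_ *: _); elim: m => [|i m IH]; first by rewrite big_nil.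
rewrite big_cons -IH; apply/esym.
by rewrite malgM_def /fgen fgmulUU mulr1.
Qed.

Lemma lrmorph_fgen_ext (R : quadRel k) (B : algType k)
    (phi psi : {lrmorphism qalg R -> B}) :
  (forall i, phi (qpi R (fgen k i)) = psi (qpi R (fgen k i))) -> phi =1 psi.
Proof.
move=> e a; have [p ->] := qpi_surj a; rewrite [p]monalgE !raddf_sum.
apply: eq_bigr => m _; rewrite monalgU_word /= !linearZ /= !rmorph_prod /=.
by congr (_ *: _); apply: eq_bigr => i _; exact: e.
Qed.

Lemma qcomp_morph (R R' : quadRel k) (phi : {lrmorphism qalg R -> qalg R'}) :
  (forall i, qcomp 1 (phi (qpi R (fgen k i)))) ->
  forall n a, qcomp n a -> qcomp n (phi a).
Proof.
move=> h n _ [p hp ->]; rewrite [p]monalgE !raddf_sum big_seq.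
have [G0 GD GZ G1 GM _ _] := qcomp_grading R'.
apply: (big_ind (qcomp n)) => [||m]; [exact: G0|exact: GD|].
rewrite -mcoeff_neq0 => /hp <-; rewrite monalgU_word /= !linearZ /= !rmorph_prod /=.
apply: GZ; elim: m => [|i m IH]; first by rewrite big_nil; exact: G1.
by rewrite big_cons; exact: (GM 1 (size m)).
Qed.

(** Mutually inverse assignments of linear forms to the generators, each
    compatible with the relations, define a graded isomorphism. *)
Lemma graded_iso_of_gens (R R' : quadRel k)
    (g : 'I_3 -> qalg R') (g' : 'I_3 -> qalg R) :
  (forall r, r \in qrels R -> free_eval g r = 0) ->
  (forall r, r \in qrels R' -> free_eval g' r = 0) ->
  (forall i, qcomp 1 (g i)) -> (forall i, qcomp 1 (g' i)) ->
  (forall phi : {lrmorphism qalg R -> qalg R'},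
     (forall i, phi (qpi R (fgen k i)) = g i) ->
     forall i, phi (g' i) = qpi R' (fgen k i)) ->
  (forall phi : {lrmorphism qalg R' -> qalg R},
     (forall i, phi (qpi R' (fgen k i)) = g' i) ->
     forall i, phi (g i) = qpi R (fgen k i)) ->
  exists phi : {lrmorphism qgalg R -> qgalg R'},
    graded_iso phi /\ forall i, phi (qpi R (fgen k i)) = g i.
Proof.
move=> gR gR' g1 g1' K K'.
have [phi e] := exists_qlift gR; have [psi e'] := exists_qlift gR'.
have c : cancel phi psi.
  apply: (@lrmorph_fgen_ext R (qalg R) (psi \o phi) idfun) => i /=.
  by rewrite e K'.
have c' : cancel psi phi.
  apply: (@lrmorph_fgen_ext R' (qalg R') (phi \o psi) idfun) => i /=.
  by rewrite e' K.
exists phi; split=> //; split; first by exists psi.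
move=> n a; split; first by apply: qcomp_morph => i; rewrite e.
by move=> h; rewrite -[a]c; apply: qcomp_morph h => i; rewrite e'.
Qed.

End GradedMorphisms.

(** * The three families of relations *)

(** The relations of [A_(eps, del)]. *)
Definition rel_list (k : fieldType) (eps del : k) : seq (freeAlg k) :=
  [:: fx k * fy k + fy k * fx k;
      fy k * fz k + fz k * fy k + eps *: fx k ^+ 2;
      fz k * fx k + fx k * fz k + del *: fy k ^+ 2].

(** An algebra morphism maps the relations of [x, y, z] to those of the images;
    it is used for evaluations and for the projection onto the quotient. *)
Lemma eval_anticomm (k : fieldType) (F B : lalgType k) (A : F -> B)
    x y z a b c (eps del : k) :
  (forall p q, A (p + q) = A p + A q) -> (forall c p, A (c *: p) = c *: A p) ->
  (forall p q, A (p * q) = A p * A q) -> A x = a -> A y = b -> A z = c ->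
  [/\ A (x * y + y * x) = a * b + b * a,
      A (y * z + z * y + eps *: x ^+ 2) = b * c + c * b + eps *: a ^+ 2
    & A (z * x + x * z + del *: y ^+ 2) = c * a + a * c + del *: b ^+ 2].
Proof. by move=> aD aZ aM ex ey ez; rewrite !expr2 !aD !aZ !aM !ex !ey !ez. Qed.

Lemma free_eval_rels (k : fieldType) (eps del : k) (A : algType k) (g : 'I_3 -> A) :
  g 0 * g 1 + g 1 * g 0 = 0 ->
  g 1 * g 2%:R + g 2%:R * g 1 + eps *: g 0 ^+ 2 = 0 ->
  g 2%:R * g 0 + g 0 * g 2%:R + del *: g 1 ^+ 2 = 0 ->
  forall r, r \in rel_list eps del -> free_eval g r = 0.
Proof.
move=> h1 h2 h3 r.
have [e1 e2 e3] := eval_anticomm eps del (free_evalD g) (free_evalZ g)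
  (free_evalM g) (free_eval_fx g) (free_eval_fy g) (free_eval_fz g).
rewrite /rel_list !inE => /or3P[] /eqP ->; first exact: etrans e1 h1.
- exact: etrans e2 h2.
- exact: etrans e3 h3.
Qed.

Section Relations.
Variables (k : fieldType) (A : algType k) (eps del : k) (x y z : A).
Hypothesis hxy : x * y + y * x = 0.
Hypothesis hyz : y * z + z * y + eps *: x ^+ 2 = 0.
Hypothesis hzx : z * x + x * z + del *: y ^+ 2 = 0.

Lemma rel_yx : y * x = - (x * y).
Proof. by apply/eqP; rewrite -addr_eq0 addrC hxy. Qed.

Lemma rel_zy : z * y = - (y * z) - eps *: x ^+ 2.
Proof.
have /eqP := hyz; rewrite addr_eq0 => /eqP <-.
by rewrite addrA addNr add0r.
Qed.

Lemma rel_zx : z * x = - (x * z) - del *: y ^+ 2.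
Proof.
have /eqP := hzx; rewrite addr_eq0 => /eqP <-.
by rewrite [z * x + _]addrC addrA addNr add0r.
Qed.

(** If the anticommutator of [a] and [b] commutes with [b], then [b^2] commutes
    with [a].  This is why the squares of the generators are central. *)
Lemma comm_sq_of_anticomm (a b c : A) :
  a * b + b * a = c -> GRing.comm c b -> GRing.comm (b ^+ 2) a.
Proof.
move=> e cb; rewrite /GRing.comm expr2 -mulrA.
have eb : b * a = c - a * b by rewrite -e [X in X - _]addrC addrK.
by rewrite eb mulrBr [b * (a * b)]mulrA eb mulrBl cb opprB addrCA subrr addr0 -mulrA.
Qed.

Lemma comm_sq_self (a : A) : GRing.comm (a ^+ 2) a.
Proof. exact/commr_sym/commrX. Qed.

Lemma anti_yz : y * z + z * y = - (eps *: x ^+ 2).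
Proof. by apply/eqP; rewrite -addr_eq0 hyz. Qed.

Lemma anti_xz : x * z + z * x = - (del *: y ^+ 2).
Proof. by apply/eqP; rewrite -addr_eq0 [x * z + _]addrC hzx. Qed.

Lemma commZr c (a b : A) : GRing.comm a b -> GRing.comm a (- (c *: b)).
Proof. by move=> e; apply: commrN; rewrite /GRing.comm -scalerAr -scalerAl e. Qed.

Lemma comm_x2 (a : A) : a \in [:: x; y; z] -> GRing.comm (x ^+ 2) a.
Proof.
have cxy : GRing.comm (y ^+ 2) x.
  by apply: comm_sq_of_anticomm hxy _; exact/commr_sym/commr0.
rewrite !inE => /or3P[] /eqP ->; first exact: comm_sq_self.
  apply: (@comm_sq_of_anticomm _ _ 0); first by rewrite addrC.
  exact/commr_sym/commr0.
apply: comm_sq_of_anticomm; first by rewrite addrC; exact: anti_xz.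
by apply/commr_sym/commZr/commr_sym.
Qed.

Lemma comm_y2 (a : A) : a \in [:: x; y; z] -> GRing.comm (y ^+ 2) a.
Proof.
have cyx : GRing.comm (x ^+ 2) y by apply: comm_x2; rewrite !inE eqxx orbT.
rewrite !inE => /or3P[] /eqP ->; last first.
- apply: comm_sq_of_anticomm; first by rewrite addrC; exact: anti_yz.
  by apply/commr_sym/commZr/commr_sym.
- exact: comm_sq_self.
by apply: comm_sq_of_anticomm hxy _; exact/commr_sym/commr0.
Qed.

Lemma comm_z2 (a : A) : a \in [:: x; y; z] -> GRing.comm (z ^+ 2) a.
Proof.
have cxz : GRing.comm (x ^+ 2) z by apply: comm_x2; rewrite !inE eqxx !orbT.
have cyz : GRing.comm (y ^+ 2) z by apply: comm_y2; rewrite !inE eqxx !orbT.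
rewrite !inE => /or3P[] /eqP ->; last exact: comm_sq_self.
- apply: comm_sq_of_anticomm anti_xz _.
  by apply/commr_sym/commZr/commr_sym.
- apply: comm_sq_of_anticomm anti_yz _.
  by apply/commr_sym/commZr/commr_sym.
Qed.

(** Linear forms in the generators, and combinations of their squares. *)
Definition lin a b c : A := a *: x + b *: y + c *: z.
Definition sq a b c : A := a *: x ^+ 2 + b *: y ^+ 2 + c *: z ^+ 2.

Lemma sqD a b c a' b' c' : sq a b c + sq a' b' c' = sq (a + a') (b + b') (c + c').
Proof. by rewrite /sq !scalerDl addrACA [X in X + _]addrACA. Qed.

Lemma sqZ d a b c : d *: sq a b c = sq (d * a) (d * b) (d * c).
Proof. by rewrite /sq !scalerDr !scalerA. Qed.

Lemma linD a b c a' b' c' : lin a b c + lin a' b' c' = lin (a + a') (b + b') (c + c').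
Proof. by rewrite /lin !scalerDl addrACA [X in X + _]addrACA. Qed.

Lemma linZ d a b c : d *: lin a b c = lin (d * a) (d * b) (d * c).
Proof. by rewrite /lin !scalerDr !scalerA. Qed.

Lemma sq0 : sq 0 0 0 = 0.
Proof. by rewrite /sq !scale0r !addr0. Qed.

Lemma lin0 : lin 0 0 0 = 0.
Proof. by rewrite /lin !scale0r !addr0. Qed.

Lemma lin_gens : [/\ x = lin 1 0 0, y = lin 0 1 0 & z = lin 0 0 1].
Proof. by rewrite /lin !scale0r !scale1r !addr0 !add0r. Qed.

(** Polarized form of the squares of linear forms: both sides are bilinear, so
    it is enough to know the anticommutators of the generators. *)
Lemma lin_anticomm a b c a' b' c' :
  lin a b c * lin a' b' c' + lin a' b' c' * lin a b c =
  sq (a * a' *+ 2 - eps * (b * c' + b' * c)) (b * b' *+ 2 - del * (a * c' + a' * c))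
     (c * c' *+ 2).
Proof.
pose anti (u v : A) := u * v + v * u; rewrite -/(anti _ _).
have aDl u v w : anti (u + v) w = anti u w + anti v w.
  by rewrite /anti mulrDl mulrDr addrACA.
have aC u v : anti u v = anti v u by rewrite /anti addrC.
have aDr u v w : anti w (u + v) = anti w u + anti w v by rewrite aC aDl ![anti w _]aC.
have aZl d u v : anti (d *: u) v = d *: anti u v.
  by rewrite /anti -scalerAl -scalerAr scalerDr.
have aZr d u v : anti v (d *: u) = d *: anti v u by rewrite aC aZl aC.
have axx : anti x x = sq 2%:R 0 0 by rewrite /anti /sq !scale0r !addr0 -expr2 scaler_nat.
have ayy : anti y y = sq 0 2%:R 0.
  by rewrite /anti /sq !scale0r addr0 add0r -expr2 scaler_nat.
have azz : anti z z = sq 0 0 2%:R.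
  by rewrite /anti /sq !scale0r !add0r -expr2 scaler_nat.
have axy : anti x y = sq 0 0 0 by rewrite /anti /sq !scale0r !addr0.
have ayz : anti y z = sq (- eps) 0 0.
  by rewrite /sq !scale0r !addr0 scaleNr; exact: anti_yz.
have axz : anti x z = sq 0 (- del) 0.
  by rewrite /sq !scale0r addr0 add0r scaleNr; exact: anti_xz.
rewrite /lin !aDl !aDr !aZl !aZr (aC y x) (aC z x) (aC z y).
rewrite axx ayy azz axy ayz axz !sqZ !sqD.
by congr sq; ring.
Qed.

End Relations.

(** * A free module carrying the algebra *)

Section Model.
Variables (C : comNzRingType) (X Y Z E D : C).

(** The free module [C^8], whose coordinates are indexed by the monomials
    [1, x, y, z, xy, xz, yz, xyz] in this order. *)
Definition pbw : Type :=
  (((C^o * C^o) * (C^o * C^o)) * ((C^o * C^o) * (C^o * C^o)))%type.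
HB.instance Definition _ := GRing.Lmodule.on pbw.

Definition vec (a1 ax ay az axy axz ayz axyz : C) : pbw :=
  (((a1, ax), (ay, az)), ((axy, axz), (ayz, axyz))).

(** Left multiplication by the generator [i] on the basis monomials, where
    [X, Y, Z] stand for the squares of the generators and [E, D] for [eps, del]. *)
Definition pbw_op (i : 'I_3) (v : pbw) : pbw :=
  let: (((v1, vx), (vy, vz)), ((vxy, vxz), (vyz, vxyz))) := v in
  match val i with
  | 0%N => vec (X * vx) v1 (X * vxy) (X * vxz) vy vz (X * vxyz) vyz
  | 1%N => vec (Y * vy) (- (Y * vxy)) v1 (Y * vyz) (- vx) (- (Y * vxyz)) vz (- vxz)
  | _ => vec (Z * vz - D * Y * vx - E * X * vy) (E * X * vxy - Z * vxz)
             (- (D * Y * vxy) - Z * vyz) (v1 - D * Y * vxz - E * X * vyz)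
             (Z * vxyz) (E * X * vxyz - vx) (- vy - D * Y * vxyz) vxy
  end.

Lemma vecP v : exists a1 ax ay az axy axz ayz axyz,
  v = vec a1 ax ay az axy axz ayz axyz.
Proof. by case: v => [[[? ?] [? ?]] [[? ?] [? ?]]]; do 8!eexists. Qed.

Lemma vecD a1 ax ay az axy axz ayz axyz b1 bx by_ bz bxy bxz byz bxyz :
  vec a1 ax ay az axy axz ayz axyz + vec b1 bx by_ bz bxy bxz byz bxyz =
  vec (a1 + b1) (ax + bx) (ay + by_) (az + bz)
      (axy + bxy) (axz + bxz) (ayz + byz) (axyz + bxyz).
Proof. by []. Qed.

Lemma vecZ c a1 ax ay az axy axz ayz axyz :
  c *: vec a1 ax ay az axy axz ayz axyz =
  vec (c * a1) (c * ax) (c * ay) (c * az) (c * axy) (c * axz) (c * ayz) (c * axyz).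
Proof. by []. Qed.

Lemma vec_op0 a1 ax ay az axy axz ayz axyz :
  pbw_op 0 (vec a1 ax ay az axy axz ayz axyz) =
  vec (X * ax) a1 (X * axy) (X * axz) ay az (X * axyz) ayz.
Proof. by []. Qed.

Lemma vec_op1 a1 ax ay az axy axz ayz axyz :
  pbw_op 1 (vec a1 ax ay az axy axz ayz axyz) =
  vec (Y * ay) (- (Y * axy)) a1 (Y * ayz) (- ax) (- (Y * axyz)) az (- axz).
Proof. by []. Qed.

Lemma vec_op2 a1 ax ay az axy axz ayz axyz :
  pbw_op 2%:R (vec a1 ax ay az axy axz ayz axyz) =
  vec (Z * az - D * Y * ax - E * X * ay) (E * X * axy - Z * axz)
      (- (D * Y * axy) - Z * ayz) (a1 - D * Y * axz - E * X * ayz)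
      (Z * axyz) (E * X * axyz - ax) (- ay - D * Y * axyz) axy.
Proof. by []. Qed.

Definition vec_opE := (vec_op0, vec_op1, vec_op2, vecZ, vecD).

Lemma pbw_opD i v w : pbw_op i (v + w) = pbw_op i v + pbw_op i w.
Proof.
have [? [? [? [? [? [? [? [? ->]]]]]]]] := vecP v.
have [? [? [? [? [? [? [? [? ->]]]]]]]] := vecP w.
by case: (ord3P i) => ->; rewrite !vec_opE; congr vec; ring.
Qed.

Lemma pbw_opZ i c v : pbw_op i (c *: v) = c *: pbw_op i v.
Proof.
have [? [? [? [? [? [? [? [? ->]]]]]]]] := vecP v.
by case: (ord3P i) => ->; rewrite !vec_opE; congr vec; ring.
Qed.

Lemma pbw_op_sq v :
  [/\ pbw_op 0 (pbw_op 0 v) = X *: v, pbw_op 1 (pbw_op 1 v) = Y *: v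
    & pbw_op 2%:R (pbw_op 2%:R v) = Z *: v].
Proof.
have [? [? [? [? [? [? [? [? ->]]]]]]]] := vecP v.
by split; rewrite !vec_opE; congr vec; ring.
Qed.

(** The three operators satisfy the defining relations. *)
Lemma pbw_op_anticomm v :
  [/\ pbw_op 0 (pbw_op 1 v) + pbw_op 1 (pbw_op 0 v) = 0,
      pbw_op 1 (pbw_op 2%:R v) + pbw_op 2%:R (pbw_op 1 v) + E *: pbw_op 0 (pbw_op 0 v) = 0
    & pbw_op 2%:R (pbw_op 0 v) + pbw_op 0 (pbw_op 2%:R v) + D *: pbw_op 1 (pbw_op 1 v) = 0].
Proof.
have [? [? [? [? [? [? [? [? ->]]]]]]]] := vecP v.
have -> : 0 = vec 0 0 0 0 0 0 0 0 by [].
by split; rewrite !(vec_op0, vec_op1, vec_op2) ?vecZ !vecD; congr vec; ring.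
Qed.

(** A property of vectors that is closed under linear combinations holds
    everywhere if it holds on the eight basis vectors. *)
Lemma pbw_ind (P : pbw -> Prop) :
  (forall v w, P v -> P w -> P (v + w)) -> (forall c v, P v -> P (c *: v)) ->
  P (vec 1 0 0 0 0 0 0 0) -> P (vec 0 1 0 0 0 0 0 0) ->
  P (vec 0 0 1 0 0 0 0 0) -> P (vec 0 0 0 1 0 0 0 0) ->
  P (vec 0 0 0 0 1 0 0 0) -> P (vec 0 0 0 0 0 1 0 0) ->
  P (vec 0 0 0 0 0 0 1 0) -> P (vec 0 0 0 0 0 0 0 1) -> forall v, P v.
Proof.
move=> PD PZ p1 px py pz pxy pxz pyz pxyz v.
have [a1 [ax [ay [az [axy [axz [ayz [axyz ->]]]]]]]] := vecP v.
have := PD _ _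
  (PD _ _ (PD _ _ (PZ a1 _ p1) (PZ ax _ px)) (PD _ _ (PZ ay _ py) (PZ az _ pz)))
  (PD _ _ (PD _ _ (PZ axy _ pxy) (PZ axz _ pxz))
          (PD _ _ (PZ ayz _ pyz) (PZ axyz _ pxyz))).
by rewrite !vecZ !vecD; congr (P (vec _ _ _ _ _ _ _ _)); ring.
Qed.

End Model.

Arguments pbw : clear implicits.

(** Same as [eval_anticomm], for a left action [A] of an algebra on a module, in
    which the generators act by [o0], [o1], [o2]. *)
Lemma action_anticomm (k : fieldType) (C : comNzRingType) (F : lalgType k)
    (V : lmodType C) (f : k -> C) (A : V -> F -> V) o0 o1 o2 x y z v (eps del : k) :
  (forall w p q, A w (p + q) = A w p + A w q) ->
  (forall w c p, A w (c *: p) = f c *: A w p) ->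
  (forall w p q, A w (p * q) = A (A w q) p) ->
  (forall w, A w x = o0 w) -> (forall w, A w y = o1 w) ->
  (forall w, A w z = o2 w) ->
  [/\ A v (x * y + y * x) = o0 (o1 v) + o1 (o0 v),
      A v (y * z + z * y + eps *: (x * x)) =
        o1 (o2 v) + o2 (o1 v) + f eps *: o0 (o0 v)
    & A v (z * x + x * z + del *: (y * y)) =
        o2 (o0 v) + o0 (o2 v) + f del *: o1 (o1 v)].
Proof. by move=> aD aZ aM ex ey ez; rewrite !aD !aZ !aM !ex !ey !ez. Qed.

Section Action.
Variables (k : fieldType) (C : comNzRingType) (f : {rmorphism k -> C}).
Variables (X Y Z : C) (eps del : k).

Local Notation op := (pbw_op X Y Z (f eps) (f del)).

Definition pbw_word (m : word) (v : pbw C) : pbw C := foldr op v m.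

(** The action of a noncommutative polynomial [p] on the vector [v]. *)
Definition pbw_act (v : pbw C) (p : freeAlg k) : pbw C :=
  \sum_(m <- msupp p) f p@_m *: pbw_word m v.

Lemma pbw_wordD m v w : pbw_word m (v + w) = pbw_word m v + pbw_word m w.
Proof. by elim: m => //= i m ->; rewrite pbw_opD. Qed.

Lemma pbw_wordZ m c v : pbw_word m (c *: v) = c *: pbw_word m v.
Proof. by elim: m => //= i m ->; rewrite pbw_opZ. Qed.

Lemma pbw_actEw (d : {fset word}) v p : (msupp p `<=` d)%fset ->
  pbw_act v p = \sum_(m <- d) f p@_m *: pbw_word m v.
Proof.
move=> le; rewrite [LHS](big_fset_incl _ le) => //= x xd /mcoeff_outdom ->.
by rewrite raddf0 scale0r.
Qed.

Fact pbw_act_zmod_morphism v : zmod_morphism (pbw_act v).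
Proof.
move=> p q; have sub := (msuppB_le p q).
rewrite (pbw_actEw v sub) (pbw_actEw v (fsubsetUl (msupp p) (msupp q))).
rewrite (pbw_actEw v (fsubsetUr (msupp p) (msupp q))) -sumrB.
by apply: eq_bigr => m _; rewrite mcoeffB rmorphB scalerBl.
Qed.
HB.instance Definition _ v := GRing.isZmodMorphism.Build (freeAlg k) (pbw C)
  (pbw_act v) (pbw_act_zmod_morphism v).

Lemma pbw_actU v c (m : word) : pbw_act v << c *g m >> = f c *: pbw_word m v.
Proof. by rewrite (pbw_actEw _ msuppU_le) big_seq_fset1 mcoeffUU. Qed.

Lemma pbw_act_gen v i : pbw_act v (fgen k i) = op i v.
Proof. by rewrite pbw_actU rmorph1 scale1r. Qed.

Lemma pbw_act1 v : pbw_act v 1 = v.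
Proof. by rewrite pbw_actU rmorph1 scale1r. Qed.

Lemma pbw_actZv p c v : pbw_act (c *: v) p = c *: pbw_act v p.
Proof.
by rewrite scaler_sumr; apply: eq_bigr => m _; rewrite pbw_wordZ !scalerA mulrC.
Qed.

Lemma pbw_act0v p : pbw_act 0 p = 0.
Proof. by rewrite -(scale0r (0 : pbw C)) pbw_actZv !scale0r. Qed.

Lemma pbw_actM v p q : pbw_act v (p * q) = pbw_act (pbw_act v q) p.
Proof.
rewrite malgME raddf_sum /= [RHS](_ : _ =
  \sum_(m <- msupp p) pbw_act (pbw_act v q) << p@_m *g m >>); last first.
  by rewrite -raddf_sum -monalgE.
apply: eq_bigr => m _; rewrite raddf_sum /= pbw_actU.
rewrite [X in pbw_word m X]/pbw_act (big_morph _ (pbw_wordD m) (_ : _ = 0)); last first.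
  by rewrite -(scale0r (0 : pbw C)) pbw_wordZ !scale0r.
rewrite scaler_sumr; apply: eq_bigr => m' _.
rewrite pbw_actU pbw_wordZ scalerA rmorphM.
by rewrite /pbw_word foldr_cat.
Qed.

Lemma pbw_actZ v c p : pbw_act v (c *: p) = f c *: pbw_act v p.
Proof. by rewrite -mul_malgC pbw_actM pbw_actU. Qed.

Variable R : quadRel k.
Hypothesis hR : qrels R =i rel_list eps del.

Lemma pbw_actD v p q : pbw_act v (p + q) = pbw_act v p + pbw_act v q.
Proof. exact: raddfD. Qed.

Lemma pbw_act_rel v r : r \in qrels R -> pbw_act v r = 0.
Proof.
have [e1 e2 e3] := action_anticomm v eps del pbw_actD pbw_actZ pbw_actM
  (fun w => pbw_act_gen w 0) (fun w => pbw_act_gen w 1)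
  (fun w => pbw_act_gen w 2%:R).
have [h1 h2 h3] := pbw_op_anticomm X Y Z (f eps) (f del) v.
rewrite hR /rel_list !inE !expr2 => /or3P[] /eqP ->.
- exact: etrans e1 h1.
- exact: etrans e2 h2.
- exact: etrans e3 h3.
Qed.

Lemma pbw_act_ideal v p : ideal_gen R p -> pbw_act v p = 0.
Proof.
move=> [s hs ->]; rewrite raddf_sum /= big_seq big1 // => t /hs tR.
apply: etrans (pbw_actM _ _ _) (etrans (pbw_actM _ _ _) _).
exact: etrans (congr1 (pbw_act^~ t.1.1) (pbw_act_rel _ tR)) (pbw_act0v _).
Qed.

(** Coordinates of an element of the algebra in the basis of the monomials
    [x^i y^j z^l] with [i, j, l <= 1]. *)
Definition pbw_coord (a : qalg R) : pbw C := pbw_act (vec 1 0 0 0 0 0 0 0) (repr a).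

Lemma pbw_coord_pi p : pbw_coord (qpi R p) = pbw_act (vec 1 0 0 0 0 0 0 0) p.
Proof.
by apply/eqP; rewrite -subr_eq0 -raddfB; apply/eqP/pbw_act_ideal/qpi_repr.
Qed.

Fact pbw_coord_zmod_morphism : zmod_morphism pbw_coord.
Proof.
move=> a b; have [p ->] := qpi_surj a; have [q ->] := qpi_surj b.
by rewrite -rmorphB !pbw_coord_pi raddfB.
Qed.
HB.instance Definition _ := GRing.isZmodMorphism.Build (qalg R) (pbw C)
  pbw_coord pbw_coord_zmod_morphism.

Lemma pbw_coord1 : pbw_coord 1 = vec 1 0 0 0 0 0 0 0.
Proof. by rewrite -(rmorph1 (qpi R)) pbw_coord_pi pbw_act1. Qed.

Lemma pbw_coordZ c a : pbw_coord (c *: a) = f c *: pbw_coord a.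
Proof.
by have [p ->] := qpi_surj a; rewrite -linearZ !pbw_coord_pi pbw_actZ.
Qed.

Lemma pbw_coord_gen i a : pbw_coord (qpi R (fgen k i) * a) = op i (pbw_coord a).
Proof.
by have [p ->] := qpi_surj a; rewrite -rmorphM !pbw_coord_pi pbw_actM pbw_act_gen.
Qed.

End Action.

(** * The algebra is free over the polynomials in the squares *)

Section SquarePolynomials.
Variable k : fieldType.

(** Polynomials in three variables [X], [Y], [Z], as iterated polynomials with
    [Z] outermost. *)
Definition spoly : idomainType := {poly {poly {poly k}}}.
Definition sX : spoly := 'X%:P%:P.
Definition sY : spoly := 'X%:P.
Definition sZ : spoly := 'X.
(** Embedding of the scalars as constants. *)
Definition sconst : {rmorphism k -> spoly} :=
  (@polyC {poly {poly k}} \o (@polyC {poly k} \o @polyC k)).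

Lemma sconst_lin_eq0 p q r :
  sconst p * sX + sconst q * sY + sconst r * sZ = 0 -> [/\ p = 0, q = 0 & r = 0].
Proof.
rewrite /sconst /sX /sY /sZ /= => e; split.
- by move: (congr1 (fun s : spoly => s.[0].[0].[1]) e); rewrite !hornerE.
- by move: (congr1 (fun s : spoly => s.[0].[1].[0]) e); rewrite !hornerE.
- by move: (congr1 (fun s : spoly => s.[1].[0].[0]) e); rewrite !hornerE.
Qed.

End SquarePolynomials.

Lemma comm_horner_morph (R S : nzRingType) (f : {rmorphism R -> S}) (u v : S)
    (cfu : commr_rmorph f u) :
  GRing.comm v u -> (forall c, GRing.comm v (f c)) ->
  forall p, GRing.comm v (horner_morph cfu p).
Proof.
move=> cvu cvf; elim/poly_ind => [|p c IH]; first by rewrite rmorph0; exact: commr0.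
rewrite rmorphD rmorphM /= horner_morphX horner_morphC.
by apply: commrD => //; apply: commrM.
Qed.

Section SquareEvaluation.
Variables (k : fieldType) (A : algType k) (eps del : k) (x y z : A).
Hypothesis hxy : x * y + y * x = 0.
Hypothesis hyz : y * z + z * y + eps *: x ^+ 2 = 0.
Hypothesis hzx : z * x + x * z + del *: y ^+ 2 = 0.

Fact sq_eval1_comm : commr_rmorph (horner_alg (x ^+ 2)) (y ^+ 2).
Proof.
apply: comm_horner_morph; last by move=> c; exact: in_alg_comm.
by apply/commr_sym/commrX/(comm_x2 hxy hzx); rewrite !inE eqxx orbT.
Qed.

(** Substitution of [x^2, y^2] for [X, Y]. *)
Definition sq_eval1 := horner_morph sq_eval1_comm.

Fact sq_eval2_comm : commr_rmorph sq_eval1 (z ^+ 2).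
Proof.
apply: comm_horner_morph.
  by apply/commr_sym/commrX/(comm_y2 hxy hyz hzx); rewrite !inE eqxx !orbT.
apply: comm_horner_morph; last by move=> c; exact: in_alg_comm.
by apply/commr_sym/commrX/(comm_x2 hxy hzx); rewrite !inE eqxx !orbT.
Qed.

(** Substitution of [x^2, y^2, z^2] for [X, Y, Z]; the conditions for it to be a
    morphism into a noncommutative algebra hold because the squares commute. *)
Definition sq_eval : {rmorphism spoly k -> A} := horner_morph sq_eval2_comm.

Lemma sq_evalX : sq_eval (sX k) = x ^+ 2.
Proof. exact: etrans (horner_morphC _ _) (etrans (horner_morphC _ _) (horner_morphX _)). Qed.

Lemma sq_evalY : sq_eval (sY k) = y ^+ 2.
Proof. exact: etrans (horner_morphC _ _) (horner_morphX _). Qed.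

Lemma sq_evalZ : sq_eval (sZ k) = z ^+ 2.
Proof. exact: horner_morphX. Qed.

Lemma sq_eval_const c : sq_eval (sconst k c) = c%:A.
Proof.
apply: etrans (horner_morphC _ _) (etrans (horner_morphC _ _) _).
exact: horner_morphC.
Qed.

Lemma sq_eval_comm p a : a \in [:: x; y; z] -> GRing.comm a (sq_eval p).
Proof.
move=> ha; apply: comm_horner_morph; first exact/commr_sym/(comm_z2 hxy hyz hzx).
apply: comm_horner_morph; first exact/commr_sym/(comm_y2 hxy hyz hzx).
apply: comm_horner_morph; first exact/commr_sym/(comm_x2 hxy hzx).
by move=> c; exact: in_alg_comm.
Qed.

End SquareEvaluation.

Section Structure.
Variables (k : fieldType) (A : algType k) (eps del : k) (x y z : A).
Hypothesis hxy : x * y + y * x = 0.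
Hypothesis hyz : y * z + z * y + eps *: x ^+ 2 = 0.
Hypothesis hzx : z * x + x * z + del *: y ^+ 2 = 0.

Variables (C : comNzRingType) (X Y Z E D : C).
Local Notation op := (pbw_op X Y Z E D).

Variable phi : {rmorphism C -> A}.
Hypothesis phiX : phi X = x ^+ 2.
Hypothesis phiY : phi Y = y ^+ 2.
Hypothesis phiZ : phi Z = z ^+ 2.
Hypothesis phiE : phi E = eps%:A.
Hypothesis phiD : phi D = del%:A.
Hypothesis phi_comm : forall p a, a \in [:: x; y; z] -> GRing.comm a (phi p).

(** The element of the algebra with given coordinates in the basis monomials,
    the coefficients being evaluated by [phi]. *)
Definition pbw_sum (v : pbw C) : A :=
  let: (((v1, vx), (vy, vz)), ((vxy, vxz), (vyz, vxyz))) := v in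
  phi v1 + phi vx * x + (phi vy * y + phi vz * z)
  + (phi vxy * (x * y) + phi vxz * (x * z) + (phi vyz * (y * z) + phi vxyz * (x * (y * z)))).

Lemma pbw_sumE v1 vx vy vz vxy vxz vyz vxyz :
  pbw_sum (vec v1 vx vy vz vxy vxz vyz vxyz) =
  phi v1 + phi vx * x + (phi vy * y + phi vz * z)
  + (phi vxy * (x * y) + phi vxz * (x * z)
  + (phi vyz * (y * z) + phi vxyz * (x * (y * z)))).
Proof. by []. Qed.

Lemma pbw_sumD v w : pbw_sum (v + w) = pbw_sum v + pbw_sum w.
Proof.
have [? [? [? [? [? [? [? [? ->]]]]]]]] := vecP v.
have [? [? [? [? [? [? [? [? ->]]]]]]]] := vecP w.
rewrite vecD !pbw_sumE !raddfD /= !mulrDl.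
have aca (a b c d a' b' c' d' : A) :
  a + a' + (b + b') + (c + c' + (d + d')) = a + b + (c + d) + (a' + b' + (c' + d')).
  by rewrite [a + a' + _]addrACA [c + c' + _]addrACA [LHS]addrACA.
exact: etrans (congr2 +%R (aca _ _ _ _ _ _ _ _) (aca _ _ _ _ _ _ _ _)) (addrACA _ _ _ _).
Qed.

Lemma pbw_sumZ c v : pbw_sum (c *: v) = phi c * pbw_sum v.
Proof.
have [? [? [? [? [? [? [? [? ->]]]]]]]] := vecP v.
by rewrite vecZ !pbw_sumE !rmorphM !mulrDr !mulrA.
Qed.

(** The operators on coordinates do compute left multiplication.  By linearity
    this is checked on the eight basis monomials, where it amounts to moving a
    generator to its place with the relations. *)
Lemma pbw_sum_op i v : pbw_sum (op i v) = nth 0 [:: x; y; z] i * pbw_sum v.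
Proof.
have mi : nth 0 [:: x; y; z] i \in [:: x; y; z] by exact: mem_nth.
have phiEX : phi (E * X) = eps *: x ^+ 2 by rewrite rmorphM phiE phiX mulr_algl.
have phiDY : phi (D * Y) = del *: y ^+ 2 by rewrite rmorphM phiD phiY mulr_algl.
have cxx : GRing.comm (x ^+ 2) x by exact: comm_sq_self.
have cyx : GRing.comm (y ^+ 2) x by apply: (comm_y2 hxy hyz hzx); rewrite !inE eqxx.
have czx : GRing.comm (z ^+ 2) x by apply: (comm_z2 hxy hyz hzx); rewrite !inE eqxx.
have czy : GRing.comm (z ^+ 2) y.
  by apply: (comm_z2 hxy hyz hzx); rewrite !inE eqxx orbT.
have czxy : GRing.comm (z ^+ 2) (x * y) by apply: commrM.
have xE : x * (eps *: x ^+ 2) = eps *: x ^+ 2 * x by rewrite -scalerAr -scalerAl cxx.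
have zyz : z * (y * z) = - (z ^+ 2 * y) - eps *: x ^+ 2 * z.
  rewrite mulrA (rel_zy hyz) mulrBl mulNr czy.
  by rewrite -[y * z * z]mulrA.
elim/pbw_ind: v => [v w IHv IHw|c v IHv||||||||].
- by rewrite pbw_opD !pbw_sumD IHv IHw mulrDr.
- by rewrite pbw_opZ !pbw_sumZ IHv !mulrA (phi_comm c mi).
all: have yx := rel_yx hxy; have zy := rel_zy hyz; have zx := rel_zx hzx.
all: case: (ord3P i) => ->; rewrite ?vec_op0 ?vec_op1 ?vec_op2 !pbw_sumE /=.
all: rewrite !(mulr0, mulr1, oppr0, subr0, sub0r, add0r, addr0, rmorph0, rmorph1,
  rmorphN, mul0r, mul1r) /=.
all: rewrite ?mulN1r ?mulNr ?phiEX ?phiDY ?phiX ?phiY ?phiZ -?expr2 //.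
- by rewrite zx addrC.
- by rewrite zy addrC.
- by rewrite mulrA.
- by rewrite cyx [y * (x * y)]mulrA yx mulNr -[x * y * y]mulrA.
- by rewrite [z * (x * y)]mulrA zx mulrBl mulNr -[x * z * y]mulrA zy mulrBr mulrN
    opprB opprK xE addrAC.
- by rewrite mulrA.
- by rewrite [y * (x * z)]mulrA yx mulNr -[x * y * z]mulrA.
- by rewrite czx [z * (x * z)]mulrA zx mulrBl mulNr -[x * z * z]mulrA.
- by rewrite mulrA.
- by rewrite [x * (x * _)]mulrA.
- have -> : y ^+ 2 * (x * z) = x * (y * (y * z)) by rewrite mulrA cyx -mulrA expr2 -mulrA.
  by rewrite [y * (x * _)]mulrA yx mulNr -[x * y * (y * z)]mulrA.
- rewrite [z * (x * _)]mulrA zx mulrBl mulNr -[x * z * (y * z)]mulrA zyz.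
  rewrite mulrBr mulrN opprB opprK [x * (_ *: _ * _)]mulrA xE -[_ *: _ * x * z]mulrA.
  by rewrite [x * (z ^+ 2 * y)]mulrA -czx -mulrA [X in _ = X - _]addrC.
Qed.

End Structure.

Section Coordinates.
Variables (k : fieldType) (A : algType k) (eps del : k) (x y z : A).
Hypothesis hxy : x * y + y * x = 0.
Hypothesis hyz : y * z + z * y + eps *: x ^+ 2 = 0.
Hypothesis hzx : z * x + x * z + del *: y ^+ 2 = 0.

Variables (C : idomainType) (f : {rmorphism k -> C}) (X Y Z : C).
Local Notation op := (pbw_op X Y Z (f eps) (f del)).
Hypothesis f_lin_eq0 : forall p q r,
  f p * X + f q * Y + f r * Z = 0 -> [/\ p = 0, q = 0 & r = 0].

Variable phi : {rmorphism C -> A}.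
Hypothesis phiX : phi X = x ^+ 2.
Hypothesis phiY : phi Y = y ^+ 2.
Hypothesis phiZ : phi Z = z ^+ 2.
Hypothesis phi_const : forall c, phi (f c) = c%:A.
Hypothesis phi_comm : forall p a, a \in [:: x; y; z] -> GRing.comm a (phi p).

Variable T : A -> pbw C.
Hypothesis TD : forall a b, T (a + b) = T a + T b.
Hypothesis TZ : forall c a, T (c *: a) = f c *: T a.
Hypothesis T1 : T 1 = vec 1 0 0 0 0 0 0 0.
Hypothesis Tx : forall a, T (x * a) = op 0 (T a).
Hypothesis Ty : forall a, T (y * a) = op 1 (T a).
Hypothesis Tz : forall a, T (z * a) = op 2%:R (T a).
Hypothesis A_ind : forall P : A -> Prop, P 1 ->
  (forall a b, P a -> P b -> P (a + b)) -> (forall c a, P a -> P (c *: a)) ->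
  (forall a, P a -> P (x * a)) -> (forall a, P a -> P (y * a)) ->
  (forall a, P a -> P (z * a)) -> forall a, P a.

(** The coordinate map is injective, [pbw_sum] being a left inverse. *)
Lemma coordK a : pbw_sum x y z phi (T a) = a.
Proof.
have so := pbw_sum_op hxy hyz hzx phiX phiY phiZ (phi_const eps) (phi_const del) phi_comm.
elim/A_ind: a => [|a b IHa IHb|c a IH|a IH|a IH|a IH].
- by rewrite T1 pbw_sumE !rmorph0 rmorph1 !mul0r !addr0.
- by rewrite TD pbw_sumD IHa IHb.
- by rewrite TZ pbw_sumZ IH phi_const mulr_algl.
- by rewrite Tx so IH.
- by rewrite Ty so IH.
- by rewrite Tz so IH.
Qed.

Lemma vec_eq0 (a1 ax ay az axy axz ayz axyz : C) :
  vec a1 ax ay az axy axz ayz axyz = 0 ->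
  [/\ a1 = 0, ax = 0, ay = 0 & az = 0] /\ [/\ axy = 0, axz = 0, ayz = 0 & axyz = 0].
Proof. by move=> e; split; split; case: e. Qed.

(** A combination of squares acts on coordinates as a scalar. *)
Lemma coord_sqM p q r a :
  T (sq x y z p q r * a) = (f p * X + f q * Y + f r * Z) *: T a.
Proof.
have [s0 s1 s2] := pbw_op_sq X Y Z (f eps) (f del) (T a).
have combine (V : lmodType C) (v : V) (a0 b0 c0 : C) :
    a0 *: (X *: v) + b0 *: (Y *: v) + c0 *: (Z *: v) = (a0 * X + b0 * Y + c0 * Z) *: v.
  by rewrite !scalerDl !scalerA.
rewrite /sq !mulrDl -!scalerAl !expr2 -!mulrA !TD !TZ !Tx !Ty !Tz s0 s1 s2.
exact: combine.
Qed.

Lemma coord_inj0 a : T a = 0 -> a = 0.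
Proof.
move=> e; rewrite -[a]coordK e.
by rewrite -(scale0r (0 : pbw C)) pbw_sumZ rmorph0 mul0r.
Qed.

Lemma coord_regular p q r a :
  [|| p != 0, q != 0 | r != 0] -> sq x y z p q r * a = 0 -> a = 0.
Proof.
move=> nz e; apply: coord_inj0.
have T0 : T 0 = 0 by rewrite -(scale0r (0 : A)) TZ rmorph0 !scale0r.
have := coord_sqM p q r a; rewrite e T0.
set c := f p * X + _ + _ => /esym.
have c0 : c != 0.
  apply/eqP => /f_lin_eq0[p0 q0 r0].
  by move: nz; rewrite p0 q0 r0 eqxx.
have [a1 [ax [ay [az [axy [axz [ayz [axyz ->]]]]]]]] := vecP (T a).
rewrite vecZ => /vec_eq0[[/eqP e1 /eqP e2 /eqP e3 /eqP e4] [/eqP e5 /eqP e6 /eqP e7 /eqP e8]].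
by move: e1 e2 e3 e4 e5 e6 e7 e8; rewrite !mulf_eq0 !(negbTE c0) /= =>
  /eqP-> /eqP-> /eqP-> /eqP-> /eqP-> /eqP-> /eqP-> /eqP->.
Qed.

Lemma coord_gens : [/\ T x = vec 0 1 0 0 0 0 0 0, T y = vec 0 0 1 0 0 0 0 0
  & T z = vec 0 0 0 1 0 0 0 0].
Proof.
split; rewrite -[X in T X]mulr1 ?Tx ?Ty ?Tz T1 !(vec_op0, vec_op1, vec_op2);
  congr vec; ring.
Qed.

Lemma lin_eq0 a b c : lin x y z a b c = 0 -> [/\ a = 0, b = 0 & c = 0].
Proof.
have [tx ty tz] := coord_gens.
have T0 : T 0 = 0 by rewrite -(scale0r (0 : A)) TZ rmorph0 !scale0r.
move=> /(congr1 T); rewrite T0 /lin !TD !TZ tx ty tz !vecZ !vecD => /vec_eq0[[_ e1 e2 e3] _].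
move: e1 e2 e3; rewrite !mulr1 !mulr0 !addr0 !add0r.
by move=> /eqP + /eqP + /eqP; rewrite !fmorph_eq0 => /eqP-> /eqP-> /eqP->.
Qed.

Lemma sq_eq0 p q r : sq x y z p q r = 0 -> [/\ p = 0, q = 0 & r = 0].
Proof.
have T0 : T 0 = 0 by rewrite -(scale0r (0 : A)) TZ rmorph0 !scale0r.
move=> e; have := coord_sqM p q r 1; rewrite mulr1 e T0 T1 vecZ => /esym.
by move=> /vec_eq0[[+ _ _ _] _]; rewrite mulr1 => /f_lin_eq0.
Qed.

Lemma sq_central p q r : central (sq x y z p q r).
Proof.
have c a : a \in [:: x; y; z] -> sq x y z p q r * a = a * sq x y z p q r.
  move=> h; rewrite /sq !mulrDl !mulrDr -!scalerAl -!scalerAr.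
  by rewrite (comm_x2 hxy hzx h) (comm_y2 hxy hyz hzx h) (comm_z2 hxy hyz hzx h).
have cx : x \in [:: x; y; z] by rewrite !inE eqxx.
have cy : y \in [:: x; y; z] by rewrite !inE eqxx orbT.
have cz : z \in [:: x; y; z] by rewrite !inE eqxx !orbT.
elim/A_ind => [|a b IHa IHb|d a IH|a IH|a IH|a IH].
- by rewrite mulr1 mul1r.
- by rewrite mulrDr IHa IHb mulrDl.
- by rewrite -scalerAr -scalerAl IH.
- by rewrite mulrA c // -!mulrA IH.
- by rewrite mulrA c // -!mulrA IH.
- by rewrite mulrA c // -!mulrA IH.
Qed.

(** A central element of degree 2 has no component along [xy, yz, xz]: compare
    coordinates after multiplying by [x] and by [y] on both sides. *)
Lemma central_deg2 p q r u v w : (2%:R : k) != 0 ->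
  central (sq x y z p q r + (u *: (x * y) + v *: (y * z) + w *: (x * z))) ->
  [/\ u = 0, v = 0 & w = 0].
Proof.
move=> two_neq0 h.
have {}h a : (u *: (x * y) + v *: (y * z) + w *: (x * z)) * a =
             a * (u *: (x * y) + v *: (y * z) + w *: (x * z)).
  by have := h a; rewrite mulrDl mulrDr sq_central => /addrI.
have [tx ty tz] := coord_gens.
have := congr1 T (h x); have := congr1 T (h y).
rewrite !mulrDl !mulrDr -!scalerAl -!scalerAr -!mulrA !TD !TZ !(Tx, Ty, Tz) tx ty tz.
rewrite !(vec_op0, vec_op1, vec_op2) !vecZ !vecD.
move=> ey ex.
(* The coordinates of [xy x] and [x xy] along [y], of [xz x] and [x xz] along [z],
   and of [yz y] and [y yz] along [z] have opposite leading terms. *)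
have eu := congr1 (fun v : pbw C => v.1.2.1) ex.
have ew := congr1 (fun v : pbw C => v.1.2.2) ex.
have ev := congr1 (fun v : pbw C => v.1.2.2) ey.
move: eu ev ew => {ex ey} /= eu ev ew.
have cancel2 c : c *+ 2 = 0 -> c = 0 :> k.
  by move=> /eqP; rewrite -mulr_natr mulf_eq0 (negbTE two_neq0) orbF => /eqP.
have move0 (a b : C) : a = b -> b - a = 0 by move=> ->; rewrite subrr.
split.
- have [|/cancel2 //] := @f_lin_eq0 (u *+ 2) (del * v) 0.
  by rewrite !rmorphM rmorph0 !rmorphMn -[RHS](move0 _ _ eu) /=; ring.
- have [|_ /cancel2 //] := @f_lin_eq0 0 (v *+ 2) 0.
  by rewrite rmorph0 !rmorphMn -[RHS](move0 _ _ ev) /=; ring.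
- have [|/cancel2 //] := @f_lin_eq0 (w *+ 2) 0 0.
  by rewrite rmorph0 !rmorphMn -[RHS](move0 _ _ ew) /=; ring.
Qed.

End Coordinates.

(** * Presentations in low degree *)

(** What is used about [A_(eps, del)]: its relations, its components of degree
    1 and 2, and its central regular elements of degree 2. *)
Record presentation (k : fieldType) (A : gradedAlg k) (eps del : k) (x y z : A) : Prop :=
  Presentation {
    pres_xy : x * y + y * x = 0;
    pres_yz : y * z + z * y + eps *: x ^+ 2 = 0;
    pres_zx : z * x + x * z + del *: y ^+ 2 = 0;
    pres_lin a b c : gcomp 1 (lin x y z a b c);
    pres_sq a b c : gcomp 2 (sq x y z a b c);
    pres_deg1 a : gcomp 1 a -> exists p q r, a = lin x y z p q r;
    pres_lin_eq0 a b c : lin x y z a b c = 0 -> [/\ a = 0, b = 0 & c = 0];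
    pres_sq_eq0 a b c : sq x y z a b c = 0 -> [/\ a = 0, b = 0 & c = 0];
    pres_sq_central a b c : central (sq x y z a b c);
    pres_regular a b c : [|| a != 0, b != 0 | c != 0] -> regular_elt (sq x y z a b c);
    pres_central_deg2 a : (2%:R : k) != 0 -> gcomp 2 a -> central a ->
      exists p q r, a = sq x y z p q r
  }.

Section DegreeTwo.
Variables (k : fieldType) (A : algType k) (eps del : k) (x y z : A).
Hypothesis hxy : x * y + y * x = 0.
Hypothesis hyz : y * z + z * y + eps *: x ^+ 2 = 0.
Hypothesis hzx : z * x + x * z + del *: y ^+ 2 = 0.

(** The general element of degree 2, in the basis of ordered monomials. *)
Definition quad_form p q r u v w : A :=
  sq x y z p q r + (u *: (x * y) + v *: (y * z) + w *: (x * z)).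

Lemma quad_formD p q r u v w p' q' r' u' v' w' :
  quad_form p q r u v w + quad_form p' q' r' u' v' w' =
  quad_form (p + p') (q + q') (r + r') (u + u') (v + v') (w + w').
Proof.
rewrite /quad_form -sqD addrACA; congr (_ + _).
by rewrite !scalerDl addrACA [X in X + _]addrACA.
Qed.

Lemma quad_form0 : quad_form 0 0 0 0 0 0 = 0.
Proof. by rewrite /quad_form /sq !scale0r !addr0. Qed.

Lemma quad_form_sq p q r : quad_form p q r 0 0 0 = sq x y z p q r.
Proof. by rewrite /quad_form !scale0r !addr0. Qed.

Lemma quad_formZ c p q r u v w :
  c *: quad_form p q r u v w =
  quad_form (c * p) (c * q) (c * r) (c * u) (c * v) (c * w).
Proof. by rewrite /quad_form scalerDr sqZ !scalerDr !scalerA. Qed.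

Lemma gens_mul_quad_form a b : a \in [:: x; y; z] -> b \in [:: x; y; z] ->
  exists p q r u v w, a * b = quad_form p q r u v w.
Proof.
rewrite !inE => /or3P[] /eqP -> /or3P[] /eqP ->.
- by exists 1, 0, 0, 0, 0, 0; rewrite /quad_form /sq !scale0r !addr0 scale1r.
- by exists 0, 0, 0, 1, 0, 0; rewrite /quad_form /sq !scale0r !addr0 add0r scale1r.
- by exists 0, 0, 0, 0, 0, 1; rewrite /quad_form /sq !scale0r !addr0 !add0r scale1r.
- exists 0, 0, 0, (-1), 0, 0; rewrite (rel_yx hxy).
  by rewrite /quad_form /sq !scale0r !addr0 add0r scaleN1r.
- by exists 0, 1, 0, 0, 0, 0; rewrite /quad_form /sq !scale0r !addr0 add0r scale1r.
- by exists 0, 0, 0, 0, 1, 0; rewrite /quad_form /sq !scale0r !addr0 !add0r scale1r.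
- exists 0, (- del), 0, 0, 0, (-1); rewrite (rel_zx hzx) addrC.
  by rewrite /quad_form /sq !scale0r !addr0 !add0r scaleN1r scaleNr.
- exists (- eps), 0, 0, 0, (-1), 0; rewrite (rel_zy hyz) addrC.
  by rewrite /quad_form /sq !scale0r !addr0 !add0r scaleN1r scaleNr.
- by exists 0, 0, 1, 0, 0, 0; rewrite /quad_form /sq !scale0r !addr0 !add0r scale1r.
Qed.

End DegreeTwo.

Lemma mem3 (T : eqType) (p q r : T) :
  [/\ p \in [:: p; q; r], q \in [:: p; q; r] & r \in [:: p; q; r]].
Proof. by rewrite !inE !eqxx !orbT. Qed.

Section QuadraticPresentation.
Variables (k : fieldType) (R : quadRel k) (eps del : k).
Hypothesis hR : qrels R =i rel_list eps del.

Local Notation x := (qpi R (fx k)).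
Local Notation y := (qpi R (fy k)).
Local Notation z := (qpi R (fz k)).

Lemma qcomp1_gen i : qcomp 1 (qpi R (fgen k i)).
Proof. by exists (fgen k i); [exact: homog_gen |]. Qed.

Lemma qpi_rel r : r \in qrels R -> qpi R r = 0.
Proof. by move=> h; apply/eqP/qpi0P; exact: ideal_gen_mem. Qed.

Lemma qpi_anticomm :
  [/\ x * y + y * x = 0, y * z + z * y + eps *: x ^+ 2 = 0
    & z * x + x * z + del *: y ^+ 2 = 0].
Proof.
have [e1 e2 e3] := @eval_anticomm k (freeAlg k) (qalg R) (qpi R) _ _ _ _ _ _ eps del
  (@qpiD k R) (@qpiZ k R) (@qpiM k R) (erefl x) (erefl y) (erefl z).
have [m1 m2 m3] := mem3 (fx k * fy k + fy k * fx k)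
  (fy k * fz k + fz k * fy k + eps *: fx k ^+ 2)
  (fz k * fx k + fx k * fz k + del *: fy k ^+ 2).
split; [exact: etrans (esym e1) (qpi_rel (etrans (hR _) m1))
  | exact: etrans (esym e2) (qpi_rel (etrans (hR _) m2))
  | exact: etrans (esym e3) (qpi_rel (etrans (hR _) m3))].
Qed.

(** A property closed under linear combinations holds on a whole graded component
    if it holds on the words of that length. *)
Lemma qcomp_ind n (P : qalg R -> Prop) : P 0 ->
  (forall a b, P a -> P b -> P (a + b)) -> (forall c a, P a -> P (c *: a)) ->
  (forall m : word, size m = n -> P (\prod_(i <- m) qpi R (fgen k i))) ->
  forall a, qcomp n a -> P a.
Proof.
move=> P0 PD PZ Pm _ [p hp ->]; rewrite [p]monalgE raddf_sum big_seq.
apply: (big_ind P) => // m; rewrite -mcoeff_neq0 => /hp sm.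
by rewrite monalgU_word /= linearZ /= rmorph_prod; apply/PZ/Pm.
Qed.

Lemma qalg_ind (P : qalg R -> Prop) : P 1 ->
  (forall a b, P a -> P b -> P (a + b)) -> (forall c a, P a -> P (c *: a)) ->
  (forall a, P a -> P (x * a)) -> (forall a, P a -> P (y * a)) ->
  (forall a, P a -> P (z * a)) -> forall a, P a.
Proof.
move=> P1 PD PZ Px Py Pz a; have [p ->] := qpi_surj a.
rewrite [p]monalgE raddf_sum; apply: (big_ind P) => //.
  by rewrite -(scale0r 1); exact: PZ.
move=> m _; rewrite monalgU_word /= linearZ /= rmorph_prod; apply: PZ.
elim: m => [|i m IH]; first by rewrite big_nil.
by rewrite big_cons; case: (ord3P i) => ->; [exact: Px|exact: Py|exact: Pz].
Qed.

Lemma qcomp1_lin a : qcomp 1 a -> exists p q r, a = lin x y z p q r.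
Proof.
move: a; apply: qcomp_ind => [|_ _ [p [q [r ->]]] [p' [q' [r' ->]]]|c _ [p [q [r ->]]]|m].
- by exists 0, 0, 0; exact: esym (lin0 _ _ _).
- by rewrite linD; do 3!eexists.
- by rewrite linZ; do 3!eexists.
have [ex ey ez] := lin_gens x y z.
case: m => [|i [|//]] // _; rewrite big_seq1; case: (ord3P i) => ->.
- by exists 1, 0, 0; exact: ex.
- by exists 0, 1, 0; exact: ey.
- by exists 0, 0, 1; exact: ez.
Qed.

Lemma qcomp2_quad_form a : qcomp 2 a ->
  exists p q r u v w, a = quad_form x y z p q r u v w.
Proof.
have [hxy hyz hzx] := qpi_anticomm.
have inxyz i : qpi R (fgen k i) \in [:: x; y; z].
  have [m1 m2 m3] := mem3 x y z.
  case: (ord3P i) => ->; [exact: m1 | exact: m2 | exact: m3].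
move: a; apply: qcomp_ind => [|a b|c a|m].
- exists 0, 0, 0, 0, 0, 0; exact: esym (quad_form0 _ _ _).
- move=> [p [q [r [u [v [w ->]]]]]] [p' [q' [r' [u' [v' [w' ->]]]]]].
  by rewrite quad_formD; do 6!eexists.
- by move=> [p [q [r [u [v [w ->]]]]]]; rewrite quad_formZ; do 6!eexists.
case: m => [|i [|j [|//]]] // _; rewrite big_cons big_seq1.
exact: gens_mul_quad_form hxy hyz hzx _ _ (inxyz i) (inxyz j).
Qed.

Theorem qalg_presentation : @presentation k (qgalg R) eps del x y z.
Proof.
have [hxy hyz hzx] := qpi_anticomm.
have [_ GD GZ _ GM _ _] := qcomp_grading R.
pose T := pbw_coord (sconst k) (sX k) (sY k) (sZ k) eps del (R := R).
have TD a b : T (a + b) = T a + T b by exact: raddfD.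
have TZ c a : T (c *: a) = sconst k c *: T a by exact: pbw_coordZ.
have T1 : T 1 = vec 1 0 0 0 0 0 0 0 by exact: pbw_coord1.
have Ti i a : T (qpi R (fgen k i) * a) =
    pbw_op (sX k) (sY k) (sZ k) (sconst k eps) (sconst k del) i (T a).
  exact: pbw_coord_gen.
have ev0 := @sconst_lin_eq0 k.
have evX := sq_evalX hxy hyz hzx; have evY := sq_evalY hxy hyz hzx.
have evZ := sq_evalZ hxy hyz hzx; have evc := sq_eval_const hxy hyz hzx.
have evC := sq_eval_comm hxy hyz hzx.
have ind := qalg_ind.
have G1 := qcomp1_gen.
have G2 i : qcomp 2 (qpi R (fgen k i) ^+ 2) by exact: (GM 1 1).
split.
- exact: hxy.
- exact: hyz.
- exact: hzx.
- move=> a b c; apply: (GD 1); last exact: (GZ 1 _ _ (G1 2%:R)).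
  exact: (GD 1 _ _ (GZ 1 _ _ (G1 0)) (GZ 1 _ _ (G1 1))).
- move=> a b c; apply: (GD 2); last exact: (GZ 2 _ _ (G2 2%:R)).
  exact: (GD 2 _ _ (GZ 2 _ _ (G2 0)) (GZ 2 _ _ (G2 1))).
- exact: qcomp1_lin.
- exact: (lin_eq0 TD TZ T1 (Ti 0) (Ti 1) (Ti 2%:R)).
- exact: (sq_eq0 ev0 TD TZ T1 (Ti 0) (Ti 1) (Ti 2%:R)).
- exact: (sq_central hxy hyz hzx ind).
- move=> a b c nz d.
  have reg : sq x y z a b c * d = 0 -> d = 0.
    exact: (coord_regular hxy hyz hzx ev0 evX evY evZ evc evC
      TD TZ T1 (Ti 0) (Ti 1) (Ti 2%:R) ind nz).
  by split=> //; rewrite -(sq_central hxy hyz hzx ind).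
- move=> a two_neq0 /qcomp2_quad_form[p [q [r [u [v [w ->]]]]]] cen.
  have [-> -> ->] := central_deg2 hxy hyz hzx ev0 TD TZ T1
    (Ti 0) (Ti 1) (Ti 2%:R) ind two_neq0 cen.
  by exists p, q, r; exact: quad_form_sq.
Qed.

End QuadraticPresentation.

(** * The matrix of an isomorphism *)

(** Determinant of the matrix with rows [(a1, b1, c1)], [(a2, b2, c2)],
    [(a3, b3, c3)]. *)
Definition det3 (k : fieldType) (a1 b1 c1 a2 b2 c2 a3 b3 c3 : k) : k :=
  a1 * (b2 * c3 - b3 * c2) - b1 * (a2 * c3 - a3 * c2) + c1 * (a2 * b3 - a3 * b2).

(** The rows [(ai, bi, ci)] are the coordinates of three independent linear forms
    of [A_(eps', del')] that satisfy the relations of [A_(eps, del)].  Each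
    relation gives one equation for each of the squares [x^2, y^2, z^2]. *)
Record rel_matrix (k : fieldType) (eps del eps' del' a1 b1 c1 a2 b2 c2 a3 b3 c3 : k) :
    Prop := RelMatrix {
  rm_xyX : a1 * a2 *+ 2 - eps' * (b1 * c2 + b2 * c1) = 0;
  rm_xyY : b1 * b2 *+ 2 - del' * (a1 * c2 + a2 * c1) = 0;
  rm_xyZ : c1 * c2 *+ 2 = 0;
  rm_yzX : a2 * a3 *+ 2 - eps' * (b2 * c3 + b3 * c2) + eps * (a1 ^+ 2 - eps' * (b1 * c1)) = 0;
  rm_yzY : b2 * b3 *+ 2 - del' * (a2 * c3 + a3 * c2) + eps * (b1 ^+ 2 - del' * (a1 * c1)) = 0;
  rm_yzZ : c2 * c3 *+ 2 + eps * c1 ^+ 2 = 0;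
  rm_zxX : a3 * a1 *+ 2 - eps' * (b3 * c1 + b1 * c3) + del * (a2 ^+ 2 - eps' * (b2 * c2)) = 0;
  rm_zxY : b3 * b1 *+ 2 - del' * (a3 * c1 + a1 * c3) + del * (b2 ^+ 2 - del' * (a2 * c2)) = 0;
  rm_zxZ : c3 * c1 *+ 2 + del * c2 ^+ 2 = 0;
  rm_det : det3 a1 b1 c1 a2 b2 c2 a3 b3 c3 != 0
}.

Section Forward.
Variables (k : fieldType) (two_neq0 : (2%:R : k) != 0).

Lemma lin_sq (A : algType k) (eps del : k) (x y z : A) a b c :
  x * y + y * x = 0 -> y * z + z * y + eps *: x ^+ 2 = 0 ->
  z * x + x * z + del *: y ^+ 2 = 0 ->
  lin x y z a b c ^+ 2 =
  sq x y z (a ^+ 2 - eps * (b * c)) (b ^+ 2 - del * (a * c)) (c ^+ 2).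
Proof.
move=> hxy hyz hzx; have := lin_anticomm hxy hyz hzx a b c a b c.
(* The anticommutator of a form with itself is twice its square. *)
rewrite -expr2 -mulr2n -scaler_nat => /(congr1 (fun t => 2%:R^-1 *: t)).
rewrite scalerK // sqZ => ->.
have e (s t : k) : 2%:R * s = t -> 2%:R^-1 * t = s by move=> <-; rewrite mulKf.
by congr sq; apply: e; ring.
Qed.

Variables (A A' : gradedAlg k) (eps del eps' del' : k) (x y z : A) (x' y' z' : A').
Hypothesis prA : presentation eps del x y z.
Hypothesis prA' : presentation eps' del' x' y' z'.

Lemma sq_inj p q r p' q' r' : sq x' y' z' p q r = sq x' y' z' p' q' r' ->
  [/\ p = p', q = q' & r = r'].
Proof.
move=> e; have : sq x' y' z' (p - p') (q - q') (r - r') = 0.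
  rewrite -[RHS](subrr (sq x' y' z' p q r)) {2}e -scaleN1r sqZ sqD.
  by congr sq; ring.
by case/(pres_sq_eq0 prA') => /eqP + /eqP + /eqP; rewrite !subr_eq0 => /eqP-> /eqP-> /eqP->.
Qed.

Lemma lin_inj p q r p' q' r' : lin x' y' z' p q r = lin x' y' z' p' q' r' ->
  [/\ p = p', q = q' & r = r'].
Proof.
move=> e; have : lin x' y' z' (p - p') (q - q') (r - r') = 0.
  rewrite -[RHS](subrr (lin x' y' z' p q r)) {2}e -scaleN1r linZ linD.
  by congr lin; ring.
by case/(pres_lin_eq0 prA') => /eqP + /eqP + /eqP; rewrite !subr_eq0 => /eqP-> /eqP-> /eqP->.
Qed.

Variables (p q r p' q' r' : k).

(** The matrix of an isomorphism of pairs, with its effect on the coefficients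
    of the central element. *)
Lemma pair_iso_matrix :
  pair_iso (AlgPair (sq x y z p q r)) (AlgPair (sq x' y' z' p' q' r')) ->
  exists a1 b1 c1 a2 b2 c2 a3 b3 c3,
  [/\ rel_matrix eps del eps' del' a1 b1 c1 a2 b2 c2 a3 b3 c3,
   p' = p * (a1 ^+ 2 - eps' * (b1 * c1)) + q * (a2 ^+ 2 - eps' * (b2 * c2))
        + r * (a3 ^+ 2 - eps' * (b3 * c3)),
   q' = p * (b1 ^+ 2 - del' * (a1 * c1)) + q * (b2 ^+ 2 - del' * (a2 * c2))
        + r * (b3 ^+ 2 - del' * (a3 * c3))
   & r' = p * c1 ^+ 2 + q * c2 ^+ 2 + r * c3 ^+ 2].
Proof.
case=> phi [[psi K K'] gr] /= e.
have [hxy hyz hzx] := And3 (pres_xy prA) (pres_yz prA) (pres_zx prA).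
have [hxy' hyz' hzx'] := And3 (pres_xy prA') (pres_yz prA') (pres_zx prA').
have [ex ey ez] := lin_gens x y z.
have [ex' ey' ez'] := lin_gens x' y' z'.
have img a b c : exists u v w, phi (lin x y z a b c) = lin x' y' z' u v w.
  by apply: (pres_deg1 prA'); apply/gr; exact: pres_lin prA _ _ _.
have pre a b c : exists u v w, lin x' y' z' a b c = phi (lin x y z u v w).
  have [|u [v [w e1]]] := pres_deg1 prA (a := psi (lin x' y' z' a b c)).
    by apply/gr; rewrite K'; exact: pres_lin prA' _ _ _.
  by exists u, v, w; rewrite -e1 K'.
have [a1 [b1 [c1]]] := img 1 0 0; rewrite -ex => e1.
have [a2 [b2 [c2]]] := img 0 1 0; rewrite -ey => e2.
have [a3 [b3 [c3]]] := img 0 0 1; rewrite -ez => e3.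
have philin u v w : phi (lin x y z u v w) =
  lin x' y' z' (u * a1 + v * a2 + w * a3) (u * b1 + v * b2 + w * b3) (u * c1 + v * c2 + w * c3).
  by rewrite {1}/lin !raddfD /= !linearZ /= e1 e2 e3 !linZ !linD.
have phisq u v w : phi (sq x y z u v w) = u *: phi x ^+ 2 + v *: phi y ^+ 2 + w *: phi z ^+ 2.
  by rewrite {1}/sq !raddfD /= !linearZ /= !rmorphXn.
have lsq := lin_sq _ _ _ hxy' hyz' hzx'.
have ac := lin_anticomm hxy' hyz' hzx'.
exists a1, b1, c1, a2, b2, c2, a3, b3, c3.
have [eX eY eZ] : [/\ a1 * a2 *+ 2 - eps' * (b1 * c2 + b2 * c1) = 0,
    b1 * b2 *+ 2 - del' * (a1 * c2 + a2 * c1) = 0 & c1 * c2 *+ 2 = 0].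
  apply: (pres_sq_eq0 prA'); rewrite -ac -e1 -e2 -!rmorphM -rmorphD hxy; exact: rmorph0.
have [eX1 eY1 eZ1] : [/\
   a2 * a3 *+ 2 - eps' * (b2 * c3 + b3 * c2) + eps * (a1 ^+ 2 - eps' * (b1 * c1)) = 0,
   b2 * b3 *+ 2 - del' * (a2 * c3 + a3 * c2) + eps * (b1 ^+ 2 - del' * (a1 * c1)) = 0
  & c2 * c3 *+ 2 + eps * c1 ^+ 2 = 0].
  apply: (pres_sq_eq0 prA'); rewrite -sqD -sqZ -ac -lsq -e1 -e2 -e3.
  by rewrite -!rmorphM -rmorphXn -linearZ -!rmorphD hyz; exact: rmorph0.
have [eX2 eY2 eZ2] : [/\
   a3 * a1 *+ 2 - eps' * (b3 * c1 + b1 * c3) + del * (a2 ^+ 2 - eps' * (b2 * c2)) = 0,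
   b3 * b1 *+ 2 - del' * (a3 * c1 + a1 * c3) + del * (b2 ^+ 2 - del' * (a2 * c2)) = 0
  & c3 * c1 *+ 2 + del * c2 ^+ 2 = 0].
  apply: (pres_sq_eq0 prA'); rewrite -sqD -sqZ -ac -lsq -e1 -e2 -e3.
  by rewrite -!rmorphM -rmorphXn -linearZ -!rmorphD hzx; exact: rmorph0.
have [ep eq er] : [/\
   p' = p * (a1 ^+ 2 - eps' * (b1 * c1)) + q * (a2 ^+ 2 - eps' * (b2 * c2))
        + r * (a3 ^+ 2 - eps' * (b3 * c3)),
   q' = p * (b1 ^+ 2 - del' * (a1 * c1)) + q * (b2 ^+ 2 - del' * (a2 * c2))
        + r * (b3 ^+ 2 - del' * (a3 * c3))
   & r' = p * c1 ^+ 2 + q * c2 ^+ 2 + r * c3 ^+ 2].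
  by apply: sq_inj; rewrite -e phisq e1 e2 e3 !lsq !sqZ !sqD.
split=> //; split=> //.
have [n11 [n12 [n13]]] := pre 1 0 0; rewrite philin => /lin_inj[m11 m12 m13].
have [n21 [n22 [n23]]] := pre 0 1 0; rewrite philin => /lin_inj[m21 m22 m23].
have [n31 [n32 [n33]]] := pre 0 0 1; rewrite philin => /lin_inj[m31 m32 m33].
(* The inverse image of each generator is a linear form, which gives a matrix
   inverse to that of the isomorphism. *)
apply/eqP => d0.
have : det3 n11 n12 n13 n21 n22 n23 n31 n32 n33 * det3 a1 b1 c1 a2 b2 c2 a3 b3 c3 = 1.
  transitivity (det3 (n11 * a1 + n12 * a2 + n13 * a3) (n11 * b1 + n12 * b2 + n13 * b3)
     (n11 * c1 + n12 * c2 + n13 * c3) (n21 * a1 + n22 * a2 + n23 * a3)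
     (n21 * b1 + n22 * b2 + n23 * b3) (n21 * c1 + n22 * c2 + n23 * c3)
     (n31 * a1 + n32 * a2 + n33 * a3) (n31 * b1 + n32 * b2 + n33 * b3)
     (n31 * c1 + n32 * c2 + n33 * c3)); first by rewrite /det3; ring.
  rewrite -m11 -m12 -m13 -m21 -m22 -m23 -m31 -m32 -m33 /det3; ring.
by rewrite d0 mulr0 => /esym/eqP; rewrite oner_eq0.
Qed.

End Forward.

(** * Solving the matrix equations *)

Section Scalars.
Variables (k : fieldType) (two_neq0 : (2%:R : k) != 0).

Lemma mul2_eq0 (u v : k) : u * v *+ 2 = 0 -> u = 0 \/ v = 0.
Proof.
move/eqP; rewrite -mulr_natr !mulf_eq0 (negbTE two_neq0) orbF.
by case/orP => /eqP ->; [left|right].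
Qed.

(** A column whose entries have pairwise zero products has at most one nonzero
    entry. *)
Lemma orthogonal_column (u1 u2 u3 : k) :
  u1 * u2 *+ 2 = 0 -> u2 * u3 *+ 2 = 0 -> u3 * u1 *+ 2 = 0 ->
  [\/ u2 = 0 /\ u3 = 0, u1 = 0 /\ u3 = 0 | u1 = 0 /\ u2 = 0].
Proof.
move=> /mul2_eq0[e|e] /mul2_eq0[e'|e'] /mul2_eq0[e''|e''];
  by [apply: Or31 | apply: Or32 | apply: Or33].
Qed.

Lemma sq_eq0E (u : k) : u ^+ 2 = 0 -> u = 0.
Proof. by move/eqP; rewrite sqrf_eq0 => /eqP. Qed.

Lemma expr02 : 0 ^+ 2 = 0 :> k. Proof. by rewrite expr0n. Qed.

(** Simplification of the terms that vanish with a zero entry. *)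
Definition simp0 := (@mul0r k, @mulr0 k, @subr0 k, @sub0r k, @addr0 k, @add0r k,
  @oppr0 k, @mul1r k, @mul0rn k, expr02).

Variables (a1 b1 c1 a2 b2 c2 a3 b3 c3 p q r p' q' r' : k).

(** Each column has exactly one nonzero entry, and invertibility puts these
    entries in distinct rows: the matrix is monomial. *)
Lemma rel_matrix_S_S :
  rel_matrix 0 0 0 0 a1 b1 c1 a2 b2 c2 a3 b3 c3 ->
  p' = p * (a1 ^+ 2 - 0 * (b1 * c1)) + q * (a2 ^+ 2 - 0 * (b2 * c2))
     + r * (a3 ^+ 2 - 0 * (b3 * c3)) ->
  q' = p * (b1 ^+ 2 - 0 * (a1 * c1)) + q * (b2 ^+ 2 - 0 * (a2 * c2))
     + r * (b3 ^+ 2 - 0 * (a3 * c3)) ->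
  r' = p * c1 ^+ 2 + q * c2 ^+ 2 + r * c3 ^+ 2 ->
  ((p' != 0%R) + (q' != 0%R) + (r' != 0%R) = (p != 0%R) + (q != 0%R) + (r != 0%R))%N.
Proof.
case; rewrite !simp0 => h1 h2 h3 h4 h5 h6 h7 h8 h9 d -> -> ->.
have nzM (s t : k) : t != 0 -> (s * t ^+ 2 != 0) = (s != 0).
  by move=> t0; rewrite mulf_eq0 sqrf_eq0 (negbTE t0) orbF.
case: (orthogonal_column h1 h4 h7) d => -[-> ->] d;
case: (orthogonal_column h2 h5 h8) d => -[-> ->] d;
case: (orthogonal_column h3 h6 h9) d => -[-> ->];
  rewrite /det3 !simp0 ?eqxx //= ?mulrN ?oppr_eq0 !mulf_eq0 !negb_or;
  move=> /and3P[-> -> ->]; rewrite !andbT;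
  by case: (p != 0); case: (q != 0); case: (r != 0).
Qed.

(** The columns of [b] and [c] each have one nonzero entry, in distinct rows.  The
    equations for [x^2] then force the product of these two entries to vanish. *)
Lemma rel_matrix_S_S' : ~ rel_matrix 0 0 1 0 a1 b1 c1 a2 b2 c2 a3 b3 c3.
Proof.
case; rewrite !simp0 => h1 h2 h3 h4 h5 h6 h7 h8 h9 d.
have fin (u v w s t : k) : u * v *+ 2 - s * t = 0 -> v * w *+ 2 = 0 -> w * u *+ 2 = 0 ->
    w != 0 -> s != 0 -> t != 0 -> False.
  move=> e /mul2_eq0[v0|->]; last by rewrite eqxx.
  move=> _ _ s0 t0; move/eqP: e; rewrite v0 !simp0 oppr_eq0 mulf_eq0.
  by rewrite (negbTE s0) (negbTE t0).
case: (orthogonal_column h2 h5 h8) h1 h4 h7 d => -[-> ->] h1 h4 h7 d;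
case: (orthogonal_column h3 h6 h9) h1 h4 h7 d => -[-> ->]; rewrite !simp0 => h1 h4 h7;
  rewrite /det3 !simp0 ?eqxx //= ?mulrN ?oppr_eq0 !mulf_eq0 !negb_or;
  move=> /and3P[? ? ?]; first
    [by apply: (fin _ _ _ _ _ h1 h4 h7) | by apply: (fin _ _ _ _ _ h4 h7 h1)
    | by apply: (fin _ _ _ _ _ h7 h1 h4)].
Qed.

(** Only one entry [ci] is nonzero.  One of the other two rows has first entry
    zero, and the equations for [x^2] make its second entry zero too. *)
Lemma rel_matrix_S_NC : ~ rel_matrix 0 0 1 1 a1 b1 c1 a2 b2 c2 a3 b3 c3.
Proof.
case; rewrite !simp0 => h1 h2 h3 h4 h5 h6 h7 h8 h9 d.
have opp0 (u v : k) : v != 0 -> - (u * v) = 0 -> u = 0.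
  by move=> v0 /eqP; rewrite oppr_eq0 mulf_eq0 (negbTE v0) orbF => /eqP.
case: (orthogonal_column h3 h6 h9) h1 h2 h4 h5 h7 h8 d => -[-> ->];
  rewrite !simp0 => h1 h2 h4 h5 h7 h8 d.
- have nz : c1 != 0 by apply: contra_neq d => ->; rewrite /det3 !simp0.
  by case: (mul2_eq0 h4) => e; [move: h1 d | move: h7 d];
    rewrite /det3 e !simp0 => /(opp0 _ _ nz) ->; rewrite !simp0 ?subrr eqxx.
- have nz : c2 != 0 by apply: contra_neq d => ->; rewrite /det3 !simp0.
  by case: (mul2_eq0 h7) => e; [move: h4 d | move: h1 d];
    rewrite /det3 e !simp0 => /(opp0 _ _ nz) ->; rewrite !simp0 ?subrr eqxx.
- have nz : c3 != 0 by apply: contra_neq d => ->; rewrite /det3 !simp0.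
  by case: (mul2_eq0 h1) => e; [move: h7 d | move: h4 d];
    rewrite /det3 e !simp0 => /(opp0 _ _ nz) ->; rewrite !simp0 ?subrr eqxx.
Qed.

(** The first row has [c1 = 0] and exactly one of [c2], [c3] is nonzero; the
    equations then make one row vanish. *)
Lemma rel_matrix_S'_NC : ~ rel_matrix 1 0 1 1 a1 b1 c1 a2 b2 c2 a3 b3 c3.
Proof.
case; rewrite !simp0 => h1 h2 h3 h4 h5 h6 h7 h8 h9 d.
have opp0 (u v : k) : v != 0 -> - (u * v) = 0 -> u = 0.
  by move=> v0 /eqP; rewrite oppr_eq0 mulf_eq0 (negbTE v0) orbF => /eqP.
have c10 : c1 = 0.
  case: (mul2_eq0 h9) => // c30; move: h6; rewrite c30 !simp0; exact: sq_eq0E.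
move: h1 h2 h4 h5 h6 h7 h8 d {h3 h9}; rewrite /det3 c10 !simp0 => h1 h2 h4 h5 h6 h7 h8 d.
case: (mul2_eq0 h6) => e; move: h1 h2 h7 h8 d; rewrite e !simp0 => h1 h2 h7 h8 d.
- have nz : c3 != 0 by apply: contra_neq d => ->; rewrite !simp0.
  case: (mul2_eq0 h1) => a0.
    by move: d h7; rewrite a0 !simp0 => d /(opp0 _ _ nz) b0; move: d; rewrite b0 !simp0 eqxx.
  case: (mul2_eq0 h2) => b0; last by move: d; rewrite a0 b0 !simp0 eqxx.
  move: h8 d; rewrite b0 !simp0 => /(opp0 _ _ nz) ->; by rewrite !simp0 eqxx.
- have nz : c2 != 0 by apply: contra_neq d => ->; rewrite !simp0.
  case: (mul2_eq0 h7) => a0; last first.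
    by move: d h1; rewrite a0 !simp0 => d /(opp0 _ _ nz) b0; move: d; rewrite b0 !simp0 eqxx.
  case: (mul2_eq0 h8) => b0; first by move: d; rewrite a0 b0 !simp0 eqxx.
  move: h2 d; rewrite b0 !simp0 => /(opp0 _ _ nz) ->; by rewrite !simp0 eqxx.
Qed.

Hypothesis def_r' : r' = p * c1 ^+ 2 + q * c2 ^+ 2 + r * c3 ^+ 2.

(** The matrix is diagonal up to exchanging the last two generators. *)
Lemma rel_matrix_S'_S' :
  rel_matrix 1 0 1 0 a1 b1 c1 a2 b2 c2 a3 b3 c3 ->
  p' = p * (a1 ^+ 2 - 1 * (b1 * c1)) + q * (a2 ^+ 2 - 1 * (b2 * c2))
     + r * (a3 ^+ 2 - 1 * (b3 * c3)) ->
  q' = p * (b1 ^+ 2 - 0 * (a1 * c1)) + q * (b2 ^+ 2 - 0 * (a2 * c2))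
     + r * (b3 ^+ 2 - 0 * (a3 * c3)) ->
  exists a b c, [/\ a != 0, b != 0, c != 0 & a ^+ 2 = b * c] /\
    ((p', q', r') = (p * a ^+ 2, q * b ^+ 2, r * c ^+ 2)
     \/ (p', q', r') = (p * a ^+ 2, r * b ^+ 2, q * c ^+ 2)).
Proof.
case; rewrite def_r' !simp0 => h1 h2 h3 h4 h5 h6 h7 h8 h9 d -> ->.
have c10 : c1 = 0.
  case: (mul2_eq0 h9) => // c30; move: h6; rewrite c30 !simp0; exact: sq_eq0E.
have b10 : b1 = 0.
  case: (mul2_eq0 h8) => // b30; move: h5; rewrite b30 !simp0; exact: sq_eq0E.
move: h1 h4 h5 h6 h7 d {h2 h3 h8 h9}; rewrite /det3 c10 b10 !simp0 => h1 h4 h5 h6 h7.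
rewrite mulf_eq0 negb_or => /andP[a1nz d].
have a20 : a2 = 0 by case: (mul2_eq0 h1) => // e; rewrite e eqxx in a1nz.
have a30 : a3 = 0 by case: (mul2_eq0 h7) => // e; rewrite e eqxx in a1nz.
move: h4 d; rewrite a20 a30 !simp0; case: (mul2_eq0 h6) => e; rewrite e !simp0 => h4 d.
- move: d; rewrite mulf_eq0 negb_or => /andP[b2nz c3nz].
  have b30 : b3 = 0 by case: (mul2_eq0 h5) => // e'; rewrite e' eqxx in b2nz.
  exists a1, b2, c3; split; last by left; rewrite b30 !simp0.
  by split=> //; apply/eqP; rewrite -subr_eq0 addrC h4.
- move: d; rewrite oppr_eq0 mulf_eq0 negb_or => /andP[b3nz c2nz].
  have b20 : b2 = 0 by case: (mul2_eq0 h5) => // e'; rewrite e' eqxx in b3nz.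
  exists a1, b3, c2; split; last by right; rewrite b20 !simp0.
  by split=> //; apply/eqP; rewrite -subr_eq0 addrC h4.
Qed.

(** The matrix is diagonal up to exchanging the first two generators. *)
Lemma rel_matrix_NC_NC :
  rel_matrix 1 1 1 1 a1 b1 c1 a2 b2 c2 a3 b3 c3 ->
  p' = p * (a1 ^+ 2 - 1 * (b1 * c1)) + q * (a2 ^+ 2 - 1 * (b2 * c2))
     + r * (a3 ^+ 2 - 1 * (b3 * c3)) ->
  q' = p * (b1 ^+ 2 - 1 * (a1 * c1)) + q * (b2 ^+ 2 - 1 * (a2 * c2))
     + r * (b3 ^+ 2 - 1 * (a3 * c3)) ->
  exists a b c, [/\ a != 0, b != 0 & c != 0] /\ (a ^+ 2 = b * c /\ b ^+ 2 = a * c) /\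
    ((p', q', r') = (p * a ^+ 2, q * b ^+ 2, r * c ^+ 2)
     \/ (p', q', r') = (q * a ^+ 2, p * b ^+ 2, r * c ^+ 2)).
Proof.
case; rewrite def_r' !simp0 => h1 h2 h3 h4 h5 h6 h7 h8 h9 d -> ->.
have [c10 c20] : c1 = 0 /\ c2 = 0.
  case: (mul2_eq0 h3) => c0.
    by split=> //; apply: sq_eq0E; move: h9; rewrite c0 !simp0.
  by split=> //; apply: sq_eq0E; move: h6; rewrite c0 !simp0.
move: h1 h2 h4 h5 h7 h8 d {h3 h6 h9}; rewrite /det3 c10 c20 !simp0 => h1 h2 h4 h5 h7 h8 d.
have c3nz : c3 != 0 by apply: contra_neq d => ->; rewrite !simp0.
have half (u v : k) : u != 0 -> u * v *+ 2 = 0 -> v = 0.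
  by move=> nz /mul2_eq0[e|//]; rewrite e eqxx in nz.
case: (mul2_eq0 h1) => a0; case: (mul2_eq0 h2) => b0;
  rewrite a0 b0 ?simp0 ?eqxx // in d h4 h5 h7 h8 *.
- move: d; rewrite oppr_eq0 mulf_eq0 negb_or => /andP[b1nz].
  rewrite mulf_eq0 negb_or => /andP[a2nz _].
  have a30 := half _ _ a2nz h4.
  have b30 : b3 = 0 by apply: (half b1); rewrite // mulrC.
  exists a2, b1, c3; split=> //; split; last by right; rewrite a30 b30 !simp0.
  by split; apply/eqP; rewrite -subr_eq0 addrC ?h5 ?h7.
- move: d; rewrite mulf_eq0 negb_or => /andP[a1nz].
  rewrite mulf_eq0 negb_or => /andP[b2nz _].
  have b30 := half _ _ b2nz h5.
  have a30 : a3 = 0 by apply: (half a1); rewrite // mulrC.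
  exists a1, b2, c3; split=> //; split; last by left; rewrite a30 b30 !simp0.
  by split; apply/eqP; rewrite -subr_eq0 addrC ?h4 ?h8.
Qed.

End Scalars.

(** * Derivation-quotient algebras *)

Section LeftDerivative.
Variable k : fieldType.

Lemma lderivD i (p q : freeAlg k) : lderiv i (p + q) = lderiv i p + lderiv i q.
Proof. by apply/malgP => m; rewrite mcoeffD !lderivE mcoeffD. Qed.

Lemma lderiv0 i : lderiv i (0 : freeAlg k) = 0.
Proof. by apply/malgP => m; rewrite lderivE !mcoeff0. Qed.

(** Left derivation strips a leading generator. *)
Lemma lderiv_genM i j (p : freeAlg k) :
  lderiv i (fgen k j * p) = if j == i then p else 0.
Proof.
rewrite {1}[p]monalgE mulr_sumr (big_morph _ (lderivD i) (lderiv0 i)).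
rewrite (_ : \sum_(m <- msupp p) _ =
  \sum_(m <- msupp p) if j == i then << p@_m *g m >> else 0).
  by case: ifP => _; [rewrite -monalgE | rewrite big1].
apply: eq_bigr => m _; apply/malgP => m'; rewrite lderivE malgM_def /fgen fgmulUU mul1r.
rewrite mcoeffU; change (mmul ([:: j] : word) m) with (j :: m : word).
rewrite (_ : (j :: m == i :: m' :> word) = (j == i) && (m == m')); last by [].
by case: ifP => _ /=; rewrite ?mcoeffU ?mcoeff0.
Qed.

End LeftDerivative.

(** The derivatives of the symmetrized monomial [xyz], for an additive map [L] that
    strips one leading generator and kills words starting with another. *)
Lemma derivation_sym_words (F : nzRingType) (L : F -> F) (x y z : F) :
  (forall p q, L (p + q) = L p + L q) ->
  [/\ (forall p, L (x * p) = p) -> (forall p, L (y * p) = 0) ->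
       (forall p, L (z * p) = 0) ->
       L (x * y * z + y * z * x + z * x * y + x * z * y + z * y * x + y * x * z)
         = y * z + z * y,
      (forall p, L (x * p) = 0) -> (forall p, L (y * p) = p) ->
       (forall p, L (z * p) = 0) ->
       L (x * y * z + y * z * x + z * x * y + x * z * y + z * y * x + y * x * z)
         = z * x + x * z
    & (forall p, L (x * p) = 0) -> (forall p, L (y * p) = 0) ->
       (forall p, L (z * p) = p) ->
       L (x * y * z + y * z * x + z * x * y + x * z * y + z * y * x + y * x * z)
         = x * y + y * x].
Proof.
move=> LD; split=> Lx Ly Lz;
  by rewrite !LD -!mulrA !Lx !Ly !Lz ?addr0 ?add0r.
Qed.

Section DefiningRelations.
Variable k : fieldType.
Local Notation x := (fx k).
Local Notation y := (fy k).
Local Notation z := (fz k).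

Lemma lderiv_gens i : [/\
  forall p, lderiv i (x * p) = if 0 == i then p else 0,
  forall p, lderiv i (y * p) = if 1 == i then p else 0
  & forall p, lderiv i (z * p) = if 2%:R == i then p else 0].
Proof. by split=> p; exact: lderiv_genM. Qed.

Lemma lderiv_omegaS : [/\ lderiv 0 (omegaS k) = y * z + z * y,
  lderiv 1 (omegaS k) = z * x + x * z & lderiv 2%:R (omegaS k) = x * y + y * x].
Proof.
have [x0 y0 z0] := lderiv_gens 0; have [x1 y1 z1] := lderiv_gens 1.
have [x2 y2 z2] := lderiv_gens 2%:R.
have [e0 _ _] := derivation_sym_words x y z (@lderivD k 0).
have [_ e1 _] := derivation_sym_words x y z (@lderivD k 1).
have [_ _ e2] := derivation_sym_words x y z (@lderivD k 2%:R).
split; [exact: e0 x0 y0 z0 | exact: e1 x1 y1 z1 | exact: e2 x2 y2 z2].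
Qed.

Lemma lderiv_cubes i :
  lderiv i (x ^+ 3) = (if 0 == i then x ^+ 2 else 0) /\
  lderiv i (y ^+ 3) = (if 1 == i then y ^+ 2 else 0).
Proof. by have [ex ey _] := lderiv_gens i; split; [exact: ex | exact: ey]. Qed.

Lemma add_scale0 (V : lmodType k) (u v : V) : u = u + 0 *: v.
Proof. by rewrite scale0r addr0. Qed.

Lemma add_scale1 (V : lmodType k) (u v : V) : u + v = u + 1 *: v.
Proof. by rewrite scale1r. Qed.

Lemma mem_rot3 (T : eqType) (a b c a' b' c' : T) : a = b' -> b = c' -> c = a' ->
  [:: a; b; c] =i [:: a'; b'; c'].
Proof. by move=> -> -> -> t; rewrite !inE orbA orbC. Qed.

Lemma congr_seq3 (T : eqType) (a b c a' b' c' : T) : a = a' -> b = b' -> c = c' ->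
  [:: a; b; c] =i [:: a'; b'; c'].
Proof. by move=> -> -> ->. Qed.

Lemma algS_rels : qrels (algS k) =i rel_list 0 0.
Proof. by apply: congr_seq3 => //; exact: add_scale0. Qed.

Lemma algS'_rels : qrels (algS' k) =i rel_list 1 0.
Proof. by apply: congr_seq3; [|exact: add_scale1|exact: add_scale0]. Qed.

Lemma algNC_rels : qrels (algNC k) =i rel_list 1 1.
Proof. by apply: congr_seq3; [|exact: add_scale1|exact: add_scale1]. Qed.

Lemma potS_rels : qrels (derivRel (potS k)) =i rel_list 0 0.
Proof.
have [e0 e1 e2] := lderiv_omegaS.
apply: mem_rot3; [apply: etrans e0 _|apply: etrans e1 _|exact: e2]; exact: add_scale0.
Qed.

Lemma potS'_rels : qrels (derivRel (potS' k)) =i rel_list 1 0.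
Proof.
have [e0 e1 e2] := lderiv_omegaS; have c i := (lderiv_cubes i).1.
have add i := lderivD i (omegaS k) (x ^+ 3).
apply: mem_rot3.
- apply: etrans (add 0) (etrans (congr2 +%R e0 (c 0)) _); exact: add_scale1.
- apply: etrans (add 1) (etrans (congr2 +%R e1 (c 1)) _).
  exact: etrans (addr0 _) (add_scale0 _ _).
- exact: etrans (add 2%:R) (etrans (congr2 +%R e2 (c 2%:R)) (addr0 _)).
Qed.

Lemma potNC_rels : qrels (derivRel (potNC k)) =i rel_list 1 1.
Proof.
have [e0 e1 e2] := lderiv_omegaS; have c i := (lderiv_cubes i).1.
have c' i := (lderiv_cubes i).2.
have add i : lderiv i (omegaNC k) = lderiv i (omegaS k) + lderiv i (x ^+ 3) + lderiv i (y ^+ 3).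
  exact: etrans (lderivD i _ _) (congr1 (+%R^~ _) (lderivD i _ _)).
apply: mem_rot3.
- apply: etrans (add 0) (etrans (congr2 +%R (congr2 +%R e0 (c 0)) (c' 0)) _).
  exact: etrans (addr0 _) (add_scale1 _ _).
- apply: etrans (add 1) (etrans (congr2 +%R (congr2 +%R e1 (c 1)) (c' 1)) _).
  exact: etrans (congr1 (+%R^~ _) (addr0 _)) (add_scale1 _ _).
- apply: etrans (add 2%:R) (etrans (congr2 +%R (congr2 +%R e2 (c 2%:R)) (c' 2%:R)) _).
  exact: etrans (addr0 _) (addr0 _).
Qed.

End DefiningRelations.

(** * Elementary isomorphisms *)

Section Isomorphisms.
Variable k : fieldType.

(** The pair formed of a quadratic algebra and [p x^2 + q y^2 + r z^2]. *)
Definition sq_pair (R : quadRel k) p q r : algPair k :=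
  @AlgPair k (qgalg R) (sq (qpi R (fx k)) (qpi R (fy k)) (qpi R (fz k)) p q r).

(** The family of three values [a, b, c]. *)
Definition gens3 (T : Type) (a b c : T) (i : 'I_3) : T :=
  match val i with 0%N => a | 1%N => b | _ => c end.

(** Two families of linear forms that satisfy the same relations and invert each
    other give an isomorphism of pairs. *)
Lemma sq_pair_iso_of_gens (R R' : quadRel k) (eps del : k) a b c a' b' c' p q r :
  qrels R =i rel_list eps del -> qrels R' =i rel_list eps del ->
  (a * b + b * a = 0 /\ b * c + c * b + eps *: a ^+ 2 = 0 /\
   c * a + a * c + del *: b ^+ 2 = 0) ->
  (a' * b' + b' * a' = 0 /\ b' * c' + c' * b' + eps *: a' ^+ 2 = 0 /\
   c' * a' + a' * c' + del *: b' ^+ 2 = 0) ->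
  [/\ qcomp (R := R') 1 a, qcomp (R := R') 1 b & qcomp (R := R') 1 c] ->
  [/\ qcomp (R := R) 1 a', qcomp (R := R) 1 b' & qcomp (R := R) 1 c'] ->
  (forall phi : {lrmorphism qalg R -> qalg R'},
     phi (qpi R (fx k)) = a -> phi (qpi R (fy k)) = b -> phi (qpi R (fz k)) = c ->
     [/\ phi a' = qpi R' (fx k), phi b' = qpi R' (fy k) & phi c' = qpi R' (fz k)]) ->
  (forall phi : {lrmorphism qalg R' -> qalg R},
     phi (qpi R' (fx k)) = a' -> phi (qpi R' (fy k)) = b' -> phi (qpi R' (fz k)) = c' ->
     [/\ phi a = qpi R (fx k), phi b = qpi R (fy k) & phi c = qpi R (fz k)]) ->
  pair_iso (sq_pair R p q r) (@AlgPair k (qgalg R') (sq a b c p q r)).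
Proof.
move=> hR hR' [r1 [r2 r3]] [r1' [r2' r3']] [ga gb gc] [ga' gb' gc'] K K'.
have [|||||| phi [iso e]] := @graded_iso_of_gens k R R' (gens3 a b c) (gens3 a' b' c').
- move=> t; rewrite hR; exact: (free_eval_rels r1 r2 r3).
- move=> t; rewrite hR'; exact: (free_eval_rels r1' r2' r3').
- by move=> i; case: (ord3P i) => ->; [exact: ga | exact: gb | exact: gc].
- by move=> i; case: (ord3P i) => ->; [exact: ga' | exact: gb' | exact: gc'].
- move=> phi e; have [ea eb ec] := K phi (e 0) (e 1) (e 2%:R).
  by move=> i; case: (ord3P i) => ->; [exact: ea | exact: eb | exact: ec].
- move=> phi e; have [ea eb ec] := K' phi (e 0) (e 1) (e 2%:R).
  by move=> i; case: (ord3P i) => ->; [exact: ea | exact: eb | exact: ec].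
exists phi => //=.
have phisq (A B : algType k) (f : {lrmorphism A -> B}) (x y z : A) a0 b0 c0 :
    f x = a0 -> f y = b0 -> f z = c0 -> f (sq x y z p q r) = sq a0 b0 c0 p q r.
  by move=> <- <- <-; rewrite /sq !raddfD /= !linearZ /= !rmorphXn.
exact: (phisq _ _ phi) (e 0) (e 1) (e 2%:R).
Qed.

Section SameRelations.
Variables (A : algType k) (x y z : A) (eps del : k).
Hypothesis hxy : x * y + y * x = 0.
Hypothesis hyz : y * z + z * y + eps *: x ^+ 2 = 0.
Hypothesis hzx : z * x + x * z + del *: y ^+ 2 = 0.

(** Rescaled generators satisfy the same relations, when the factors are
    compatible with the terms in [eps] and [del]. *)
Lemma scale_rels t0 t1 t2 :
  eps * (t1 * t2) = eps * t0 ^+ 2 -> del * (t0 * t2) = del * t1 ^+ 2 ->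
  (t0 *: x) * (t1 *: y) + (t1 *: y) * (t0 *: x) = 0 /\
  (t1 *: y) * (t2 *: z) + (t2 *: z) * (t1 *: y) + eps *: (t0 *: x) ^+ 2 = 0 /\
  (t2 *: z) * (t0 *: x) + (t0 *: x) * (t2 *: z) + del *: (t1 *: y) ^+ 2 = 0.
Proof.
move=> e1 e2.
have zz s t (a b : A) : (s *: a) * (t *: b) = (s * t) *: (a * b).
  by rewrite -scalerAl -scalerAr scalerA.
split; first by rewrite !zz [t1 * t0]mulrC -scalerDr hxy scaler0.
split.
- rewrite !zz exprZn [t2 * t1]mulrC scalerA -e1 [eps * _]mulrC -[(_ * eps) *: _]scalerA.
  by rewrite -!scalerDr hyz scaler0.
- rewrite !zz exprZn [t0 * t2]mulrC scalerA -e2 [t0 * t2]mulrC [del * _]mulrC.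
  rewrite -[(_ * del) *: _]scalerA.
  by rewrite -!scalerDr hzx scaler0.
Qed.

Lemma swap_xy_rels : eps = del ->
  y * x + x * y = 0 /\ x * z + z * x + eps *: y ^+ 2 = 0 /\
  z * y + y * z + del *: x ^+ 2 = 0.
Proof.
move=> e; have := hyz; rewrite e => hyz'.
by rewrite [y * x + _]addrC [x * z + _]addrC [z * y + _]addrC hxy hzx hyz'.
Qed.

Lemma swap_yz_rels : del = 0 ->
  x * z + z * x = 0 /\ z * y + y * z + eps *: x ^+ 2 = 0 /\
  y * x + x * y + del *: z ^+ 2 = 0.
Proof.
move=> e; rewrite [z * y + _]addrC [y * x + _]addrC [x * z + _]addrC hyz e scale0r addr0 hxy.
by have := hzx; rewrite e scale0r addr0.
Qed.

Lemma sq_scale t0 t1 t2 p q r : sq (t0 *: x) (t1 *: y) (t2 *: z) p q r =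
  sq x y z (p * t0 ^+ 2) (q * t1 ^+ 2) (r * t2 ^+ 2).
Proof. by rewrite /sq !exprZn !scalerA. Qed.

Lemma sq_swap_xy p q r : sq y x z p q r = sq x y z q p r.
Proof. by rewrite /sq [_ *: y ^+ 2 + _]addrC. Qed.

Lemma sq_swap_yz p q r : sq x z y p q r = sq x y z p r q.
Proof. by rewrite /sq addrAC. Qed.

End SameRelations.

Section Moves.
Variables (R R' : quadRel k) (eps del : k).
Hypothesis hR : qrels R =i rel_list eps del.
Hypothesis hR' : qrels R' =i rel_list eps del.
Local Notation x := (qpi R (fx k)).
Local Notation y := (qpi R (fy k)).
Local Notation z := (qpi R (fz k)).
Local Notation x' := (qpi R' (fx k)).
Local Notation y' := (qpi R' (fy k)).
Local Notation z' := (qpi R' (fz k)).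

Lemma scale_pair_iso t0 t1 t2 p q r : t0 != 0 -> t1 != 0 -> t2 != 0 ->
  eps * (t1 * t2) = eps * t0 ^+ 2 -> del * (t0 * t2) = del * t1 ^+ 2 ->
  pair_iso (sq_pair R p q r)
    (sq_pair R' (p * t0 ^+ 2) (q * t1 ^+ 2) (r * t2 ^+ 2)).
Proof.
move=> n0 n1 n2 e1 e2.
have [hxy hyz hzx] := qpi_anticomm hR; have [hxy' hyz' hzx'] := qpi_anticomm hR'.
have [_ _ GZ _ _ _ _] := qcomp_grading R; have [_ _ GZ' _ _ _ _] := qcomp_grading R'.
have i1 : eps * (t1^-1 * t2^-1) = eps * t0^-1 ^+ 2.
  have [->|e0] := eqVneq eps 0; first by rewrite !mul0r.
  by rewrite -invfM (mulfI e0 e1) exprVn.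
have i2 : del * (t0^-1 * t2^-1) = del * t1^-1 ^+ 2.
  have [->|e0] := eqVneq del 0; first by rewrite !mul0r.
  by rewrite -invfM (mulfI e0 e2) exprVn.
have key (A B : algType k) (f : {lrmorphism A -> B}) t u v : t != 0 ->
    f u = t *: v -> f (t^-1 *: u) = v.
  by move=> t0nz e; rewrite linearZ /= e scalerA mulVf // scale1r.
have key' (A B : algType k) (f : {lrmorphism A -> B}) t u v : t != 0 ->
    f u = t^-1 *: v -> f (t *: u) = v.
  by move=> t0nz e; rewrite linearZ /= e scalerA mulfV // scale1r.
rewrite /sq_pair -(sq_scale x' y' z' t0 t1 t2).
apply: (sq_pair_iso_of_gens (a' := t0^-1 *: x) (b' := t1^-1 *: y) (c' := t2^-1 *: z) _ _ _ hR hR').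
- exact: scale_rels hxy' hyz' hzx' _ _ _ e1 e2.
- exact: scale_rels hxy hyz hzx _ _ _ i1 i2.
- split; apply: (GZ' 1); exact: qcomp1_gen.
- split; apply: (GZ 1); exact: qcomp1_gen.
- move=> phi ea eb ec.
  by split; [exact: key n0 ea | exact: key n1 eb | exact: key n2 ec].
- move=> phi ea eb ec.
  by split; [exact: key' n0 ea | exact: key' n1 eb | exact: key' n2 ec].
Qed.

Lemma swap_xy_pair_iso p q r : eps = del ->
  pair_iso (sq_pair R p q r) (sq_pair R' q p r).
Proof.
move=> e.
have [hxy hyz hzx] := qpi_anticomm hR; have [hxy' hyz' hzx'] := qpi_anticomm hR'.
rewrite /sq_pair -(sq_swap_xy x' y' z').
apply: (sq_pair_iso_of_gens (a' := y) (b' := x) (c' := z) _ _ _ hR hR').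
- exact: swap_xy_rels hxy' hyz' hzx' e.
- exact: swap_xy_rels hxy hyz hzx e.
- by split; exact: qcomp1_gen.
- by split; exact: qcomp1_gen.
- by move=> phi ea eb ec; split; [exact: eb | exact: ea | exact: ec].
- by move=> phi ea eb ec; split; [exact: eb | exact: ea | exact: ec].
Qed.

Lemma swap_yz_pair_iso p q r : del = 0 ->
  pair_iso (sq_pair R p q r) (sq_pair R' p r q).
Proof.
move=> e.
have [hxy hyz hzx] := qpi_anticomm hR; have [hxy' hyz' hzx'] := qpi_anticomm hR'.
rewrite /sq_pair -(sq_swap_yz x' y' z').
apply: (sq_pair_iso_of_gens (a' := x) (b' := z) (c' := y) _ _ _ hR hR').
- exact: swap_yz_rels hxy' hyz' hzx' e.
- exact: swap_yz_rels hxy hyz hzx e.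
- by split; exact: qcomp1_gen.
- by split; exact: qcomp1_gen.
- by move=> phi ea eb ec; split; [exact: ea | exact: ec | exact: eb].
- by move=> phi ea eb ec; split; [exact: ea | exact: ec | exact: eb].
Qed.

Lemma id_pair_iso p q r : pair_iso (sq_pair R p q r) (sq_pair R' p q r).
Proof.
have := @scale_pair_iso 1 1 1 p q r (oner_neq0 _) (oner_neq0 _) (oner_neq0 _).
by rewrite !expr1n !mulr1; apply.
Qed.

End Moves.
End Isomorphisms.

(** * Pairs over the three algebras *)

(** The three types S, S', NC. *)
Variant alg_kind := KindS | KindS' | KindNC.

Section Kinds.
Variable k : fieldType.

(** The parameters [eps], [del] of each type. *)
Definition kind_eps (t : alg_kind) : k := if t is KindS then 0 else 1.
Definition kind_del (t : alg_kind) : k := if t is KindNC then 1 else 0.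
Definition kind_alg (t : alg_kind) : quadRel k :=
  match t with KindS => algS k | KindS' => algS' k | KindNC => algNC k end.
Definition kind_pot (t : alg_kind) : cubicPotential k :=
  match t with KindS => potS k | KindS' => potS' k | KindNC => potNC k end.

Lemma kind_alg_rels t : qrels (kind_alg t) =i rel_list (kind_eps t) (kind_del t).
Proof. by case: t; [exact: algS_rels | exact: algS'_rels | exact: algNC_rels]. Qed.

Lemma kind_pot_rels t :
  qrels (derivRel (kind_pot t)) =i rel_list (kind_eps t) (kind_del t).
Proof. by case: t; [exact: potS_rels | exact: potS'_rels | exact: potNC_rels]. Qed.

(** The pair formed of the algebra of type [t] and [p x^2 + q y^2 + r z^2]. *)
Definition kind_pair t p q r : algPair k := sq_pair (kind_alg t) p q r.

Definition entry_kind (e : entry) : alg_kind :=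
  match e with
  | S_x | S_x_y | S_x_y_z => KindS
  | S'_x | S'_y | S'_x_y | S'_y_z | S'_ax_y_z => KindS'
  | NC_x | NC_z | NC_ax_y | NC_ax_z | NC_ax_by_z => KindNC
  end.

(** The coefficients [(p, q, r)] of the central element of each entry. *)
Definition entry_coef (e : entry) (a b : k) : k * k * k :=
  match e with
  | S_x => (1, 0, 0) | S_x_y => (1, 1, 0) | S_x_y_z => (1, 1, 1)
  | S'_x => (1, 0, 0) | S'_y => (0, 1, 0) | S'_x_y => (1, 1, 0)
  | S'_y_z => (0, 1, 1) | S'_ax_y_z => (a, 1, 1)
  | NC_x => (1, 0, 0) | NC_z => (0, 0, 1) | NC_ax_y => (a, 1, 0)
  | NC_ax_z => (a, 0, 1) | NC_ax_by_z => (a, b, 1)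
  end.

Lemma sq_special (A : algType k) (x y z : A) (a b : k) :
  [/\ [/\ x ^+ 2 = sq x y z 1 0 0, y ^+ 2 = sq x y z 0 1 0 & z ^+ 2 = sq x y z 0 0 1],
      [/\ x ^+ 2 + y ^+ 2 = sq x y z 1 1 0, y ^+ 2 + z ^+ 2 = sq x y z 0 1 1
        & x ^+ 2 + y ^+ 2 + z ^+ 2 = sq x y z 1 1 1]
    & [/\ a *: x ^+ 2 + y ^+ 2 + z ^+ 2 = sq x y z a 1 1,
          a *: x ^+ 2 + y ^+ 2 = sq x y z a 1 0,
          a *: x ^+ 2 + z ^+ 2 = sq x y z a 0 1
        & a *: x ^+ 2 + b *: y ^+ 2 + z ^+ 2 = sq x y z a b 1]].
Proof. by rewrite /sq !scale0r !scale1r !addr0 !add0r. Qed.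

Lemma entry_pairE e a b : entry_pair e a b =
  kind_pair (entry_kind e) (entry_coef e a b).1.1 (entry_coef e a b).1.2 (entry_coef e a b).2.
Proof.
have [[s1 s2 s3] [s4 s5 s6] [s7 s8 s9 s10]] :=
  sq_special (qpi (algS k) (fx k)) (qpi (algS k) (fy k)) (qpi (algS k) (fz k)) a b.
have [[u1 u2 u3] [u4 u5 u6] [u7 u8 u9 u10]] :=
  sq_special (qpi (algS' k) (fx k)) (qpi (algS' k) (fy k)) (qpi (algS' k) (fz k)) a b.
have [[v1 v2 v3] [v4 v5 v6] [v7 v8 v9 v10]] :=
  sq_special (qpi (algNC k) (fx k)) (qpi (algNC k) (fy k)) (qpi (algNC k) (fz k)) a b.
case: e.
- refine (congr1 (fun f => @AlgPair k (qgalg (algS k)) f) s1).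
- refine (congr1 (fun f => @AlgPair k (qgalg (algS k)) f) s4).
- refine (congr1 (fun f => @AlgPair k (qgalg (algS k)) f) s6).
- refine (congr1 (fun f => @AlgPair k (qgalg (algS' k)) f) u1).
- refine (congr1 (fun f => @AlgPair k (qgalg (algS' k)) f) u2).
- refine (congr1 (fun f => @AlgPair k (qgalg (algS' k)) f) u4).
- refine (congr1 (fun f => @AlgPair k (qgalg (algS' k)) f) u5).
- refine (congr1 (fun f => @AlgPair k (qgalg (algS' k)) f) u7).
- refine (congr1 (fun f => @AlgPair k (qgalg (algNC k)) f) v1).
- refine (congr1 (fun f => @AlgPair k (qgalg (algNC k)) f) v3).
- refine (congr1 (fun f => @AlgPair k (qgalg (algNC k)) f) v8).
- refine (congr1 (fun f => @AlgPair k (qgalg (algNC k)) f) v9).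
- refine (congr1 (fun f => @AlgPair k (qgalg (algNC k)) f) v10).
Qed.

Lemma entry_coef_neq0 e a b : a != 0 -> b != 0 ->
  let c := entry_coef e a b in [|| c.1.1 != 0, c.1.2 != 0 | c.2 != 0].
Proof. by move=> a0 b0; case: e; rewrite /= ?a0 ?oner_neq0 ?orbT. Qed.

Lemma kind_presentation t : @presentation k (qgalg (kind_alg t)) (kind_eps t) (kind_del t)
  (qpi (kind_alg t) (fx k)) (qpi (kind_alg t) (fy k)) (qpi (kind_alg t) (fz k)).
Proof. exact: qalg_presentation (kind_alg_rels t). Qed.

Lemma pair_iso_graded_isomorphic (P Q : algPair k) :
  pair_iso P Q -> graded_isomorphic (pair_alg P) (pair_alg Q).
Proof. by case=> phi iso _; exists phi. Qed.

Lemma kind_pair_central_regular t p q r : [|| p != 0, q != 0 | r != 0] ->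
  central_regular_pair (kind_pair t p q r).
Proof.
move=> nz; have pr := kind_presentation t; split; last exact: (pres_regular pr nz).
- have iso := pair_iso_graded_isomorphic
    (id_pair_iso (@kind_alg_rels t) (@kind_pot_rels t) 0 0 0).
  case: t iso {pr} => iso; [exact: Or31 | exact: Or32 | exact: Or33].
- exact: (pres_sq pr).
- exact: (pres_sq_central pr).
Qed.

Hypothesis two_neq0 : (2%:R : k) != 0.

(** Every central regular pair is isomorphic to one with a combination of squares,
    which is nonzero because a regular element is. *)
Lemma central_regular_pair_kind P : central_regular_pair P ->
  exists t p q r, [|| p != 0, q != 0 | r != 0] /\ pair_iso P (kind_pair t p q r).
Proof.
case: P => A f [ty f2 cen reg].
have [t [phi [[psi K K'] gr]]] : exists t,
    graded_isomorphic A (derivation_quotient (kind_pot t)).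
  by case: ty => ?; [exists KindS | exists KindS' | exists KindNC].
have pr := qalg_presentation (@kind_pot_rels t).
have cen' : central (phi f).
  by move=> d; rewrite -[d]K' -!rmorphM /=; congr (phi _); exact: cen.
have [p [q [r e]]] := pres_central_deg2 pr two_neq0 ((gr 2 f).1 f2) cen'.
exists t, p, q, r; split.
  apply/negPn/negP; rewrite !negb_or !negbK => /and3P[/eqP p0 /eqP q0 /eqP r0].
  have f0 : f = 0.
    apply: (can_inj K); apply: etrans e (etrans _ (esym (raddf0 phi))).
    by rewrite p0 q0 r0; exact: sq0.
  by have [/(_ _) + _] := reg 1; rewrite /= f0 mul0r => /(_ erefl)/eqP; rewrite oner_eq0.
apply: (@pair_iso_trans _ _ (sq_pair (derivRel (kind_pot t)) p q r)).
  by exists phi => //; split=> //; exists psi.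
exact: id_pair_iso (@kind_pot_rels t) (@kind_alg_rels t) p q r.
Qed.

Lemma kind_pair_iso_matrix t t' p q r p' q' r' :
  pair_iso (kind_pair t p q r) (kind_pair t' p' q' r') ->
  exists a1 b1 c1 a2 b2 c2 a3 b3 c3,
  [/\ rel_matrix (kind_eps t) (kind_del t) (kind_eps t') (kind_del t')
        a1 b1 c1 a2 b2 c2 a3 b3 c3,
   p' = p * (a1 ^+ 2 - kind_eps t' * (b1 * c1)) + q * (a2 ^+ 2 - kind_eps t' * (b2 * c2))
        + r * (a3 ^+ 2 - kind_eps t' * (b3 * c3)),
   q' = p * (b1 ^+ 2 - kind_del t' * (a1 * c1)) + q * (b2 ^+ 2 - kind_del t' * (a2 * c2))
        + r * (b3 ^+ 2 - kind_del t' * (a3 * c3))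
   & r' = p * c1 ^+ 2 + q * c2 ^+ 2 + r * c3 ^+ 2].
Proof.
move=> iso.
exact: (pair_iso_matrix two_neq0 (kind_presentation t) (kind_presentation t') iso).
Qed.

Lemma kind_pair_iso_kind t t' p q r p' q' r' :
  pair_iso (kind_pair t p q r) (kind_pair t' p' q' r') -> t = t'.
Proof.
move=> iso.
have [a1 [b1 [c1 [a2 [b2 [c2 [a3 [b3 [c3 [m _ _ _]]]]]]]]]] := kind_pair_iso_matrix iso.
have [a1' [b1' [c1' [a2' [b2' [c2' [a3' [b3' [c3' [m' _ _ _]]]]]]]]]] :=
  kind_pair_iso_matrix (pair_iso_sym iso).
case: t t' m m' {iso} => [] [] //= m m'.
- by case: (rel_matrix_S_S' two_neq0 m).
- by case: (rel_matrix_S_NC two_neq0 m).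
- by case: (rel_matrix_S_S' two_neq0 m').
- by case: (rel_matrix_S'_NC two_neq0 m).
- by case: (rel_matrix_S_NC two_neq0 m').
- by case: (rel_matrix_S'_NC two_neq0 m').
Qed.

Lemma kind_pair_iso_S p q r p' q' r' :
  pair_iso (kind_pair KindS p q r) (kind_pair KindS p' q' r') ->
  ((p' != 0%R) + (q' != 0%R) + (r' != 0%R) = (p != 0%R) + (q != 0%R) + (r != 0%R))%N.
Proof.
move=> /kind_pair_iso_matrix[? [? [? [? [? [? [? [? [? [m ep eq er]]]]]]]]]].
exact: rel_matrix_S_S m ep eq er.
Qed.

Lemma kind_pair_iso_S' p q r p' q' r' :
  pair_iso (kind_pair KindS' p q r) (kind_pair KindS' p' q' r') ->
  exists a b c, [/\ a != 0, b != 0, c != 0 & a ^+ 2 = b * c] /\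
    ((p', q', r') = (p * a ^+ 2, q * b ^+ 2, r * c ^+ 2)
     \/ (p', q', r') = (p * a ^+ 2, r * b ^+ 2, q * c ^+ 2)).
Proof.
move=> /kind_pair_iso_matrix[? [? [? [? [? [? [? [? [? [m ep eq er]]]]]]]]]].
exact: rel_matrix_S'_S' er m ep eq.
Qed.

Lemma kind_pair_iso_NC p q r p' q' r' :
  pair_iso (kind_pair KindNC p q r) (kind_pair KindNC p' q' r') ->
  exists a b c, [/\ a != 0, b != 0 & c != 0] /\ (a ^+ 2 = b * c /\ b ^+ 2 = a * c) /\
    ((p', q', r') = (p * a ^+ 2, q * b ^+ 2, r * c ^+ 2)
     \/ (p', q', r') = (q * a ^+ 2, p * b ^+ 2, r * c ^+ 2)).
Proof.
move=> /kind_pair_iso_matrix[? [? [? [? [? [? [? [? [? [m ep eq er]]]]]]]]]].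
exact: rel_matrix_NC_NC er m ep eq.
Qed.

End Kinds.

(** * Classification *)

(** Isomorphism of two pairs over the algebra of type [t], as a relation between
    coefficients; it is locked, so that it is never unfolded by unification. *)
HB.lock Definition kind_iso (k : fieldType) (t : alg_kind) (p q r p' q' r' : k) : Prop :=
  pair_iso (kind_pair t p q r) (kind_pair t p' q' r').

Section Moves.
Variable k : fieldType.

Lemma kind_isoP t (p q r p' q' r' : k) : kind_iso t p q r p' q' r' <->
  pair_iso (kind_pair t p q r) (kind_pair t p' q' r').
Proof. by rewrite unlock. Qed.

Lemma kind_iso_trans t (p q r p' q' r' p'' q'' r'' : k) :
  kind_iso t p q r p' q' r' -> kind_iso t p' q' r' p'' q'' r'' ->
  kind_iso t p q r p'' q'' r''.
Proof.
move=> /kind_isoP iso /kind_isoP iso'; apply/kind_isoP; exact: pair_iso_trans iso iso'.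
Qed.

Lemma kind_scale t (t0 t1 t2 p q r p' q' r' : k) : t0 != 0 -> t1 != 0 -> t2 != 0 ->
  kind_eps k t * (t1 * t2) = kind_eps k t * t0 ^+ 2 ->
  kind_del k t * (t0 * t2) = kind_del k t * t1 ^+ 2 ->
  p' = p * t0 ^+ 2 -> q' = q * t1 ^+ 2 -> r' = r * t2 ^+ 2 ->
  kind_iso t p q r p' q' r'.
Proof.
move=> n0 n1 n2 e1 e2 -> -> ->; apply/kind_isoP.
exact: (scale_pair_iso (@kind_alg_rels k t) (@kind_alg_rels k t)).
Qed.

Lemma kind_scale_const t (s p q r p' q' r' : k) : s != 0 ->
  p' = p * s ^+ 2 -> q' = q * s ^+ 2 -> r' = r * s ^+ 2 ->
  kind_iso t p q r p' q' r'.
Proof. by move=> s0; apply: kind_scale. Qed.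

Lemma kind_swap_xy t (p q r : k) : t <> KindS' ->
  kind_iso t p q r q p r.
Proof.
move=> tS'; apply/kind_isoP.
apply: (swap_xy_pair_iso (@kind_alg_rels k t) (@kind_alg_rels k t)).
by case: t tS'.
Qed.

Lemma kind_swap_yz t (p q r : k) : t <> KindNC ->
  kind_iso t p q r p r q.
Proof.
move=> tNC; apply/kind_isoP.
apply: (swap_yz_pair_iso (@kind_alg_rels k t) (@kind_alg_rels k t)).
by case: t tNC.
Qed.

Lemma kind_iso_refl t (p q r : k) : kind_iso t p q r p q r.
Proof.
apply/kind_isoP; exact: id_pair_iso (@kind_alg_rels k t) (@kind_alg_rels k t) p q r.
Qed.

End Moves.

Section Classification.
Variable k : closedFieldType.

Lemma inv_sqrt (a : k) : a != 0 -> exists2 s, s != 0 & a * s ^+ 2 = 1.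
Proof.
move=> a0.
have [s es] := @solve_monicpoly k 2 (fun i => if i is 0%N then a^-1 else 0) isT.
have {}es : a * s ^+ 2 = 1.
  by rewrite es big_ord_recl big_ord1 /= mul0r addr0 expr0 mulr1 mulfV.
exists s => //; apply/eqP => s0; move/eqP: es.
by rewrite s0 expr0n mulr0 eq_sym oner_eq0.
Qed.

Lemma exists_sqrt (a : k) : a != 0 -> exists2 s, s != 0 & s ^+ 2 = a.
Proof.
move=> a0; have [s s0 es] := inv_sqrt (invr_neq0 a0).
by exists s => //; rewrite -[LHS](mulKf (invr_neq0 a0)) es invrK mulr1.
Qed.

(** The pair of type [t] with coefficients [(p, q, r)] is isomorphic to an entry of
    the list. *)
Definition listed t (p q r : k) := exists e a b, let c := entry_coef e a b in
  [/\ a != 0, b != 0, entry_kind e = t & kind_iso t p q r c.1.1 c.1.2 c.2].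

Lemma listed_iso t (p q r p' q' r' : k) :
  kind_iso t p q r p' q' r' ->
  listed t p' q' r' -> listed t p q r.
Proof.
move=> iso [e [a [b [a0 b0 et iso']]]]; exists e, a, b; split=> //.
exact: kind_iso_trans iso iso'.
Qed.

Lemma listed_entry e (a b : k) : a != 0 -> b != 0 ->
  listed (entry_kind e) (entry_coef e a b).1.1 (entry_coef e a b).1.2 (entry_coef e a b).2.
Proof.
move=> a0 b0; exists e, a, b; split=> //.
exact: kind_iso_refl.
Qed.

Let one0 : (1 : k) != 0 := oner_neq0 k.

Lemma listed_S (p q r : k) : [|| p != 0, q != 0 | r != 0] -> listed KindS p q r.
Proof.
have norm u : exists2 s, s != 0 & u * s ^+ 2 = (u != 0)%:R :> k.
  have [->|/inv_sqrt//] := eqVneq u 0; exists 1 => //; exact: mul0r.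
have [s0 s0n e0] := norm p; have [s1 s1n e1] := norm q; have [s2 s2n e2] := norm r.
move=> nz; apply: (@listed_iso _ _ _ _ (p != 0)%:R (q != 0)%:R (r != 0)%:R).
  by apply: (kind_scale s0n s1n s2n); rewrite /= ?mul0r.
have R1 := listed_entry S_x one0 one0; have R2 := listed_entry S_x_y one0 one0.
have R3 := listed_entry S_x_y_z one0 one0.
have sxy p' q' r' :=
  listed_iso (@kind_swap_xy k KindS p' q' r' (fun e => ltac:(discriminate e))).
have syz p' q' r' :=
  listed_iso (@kind_swap_yz k KindS p' q' r' (fun e => ltac:(discriminate e))).
case: (p != 0) (q != 0) (r != 0) nz => [] [] [] //= _.
- by apply: syz; exact: R2.
- by apply: sxy; apply: syz; exact: R2.
- by apply: sxy; exact: R1.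
- by apply: syz; apply: sxy; exact: R1.
Qed.

Lemma listed_S' (p q r : k) : [|| p != 0, q != 0 | r != 0] -> listed KindS' p q r.
Proof.
have syz p' q' r' :=
  listed_iso (@kind_swap_yz k KindS' p' q' r' (fun e => ltac:(discriminate e))).
have one_r q' : q' != 0 -> listed KindS' p q' 0.
  move=> q0; have [t t0 et] := inv_sqrt q0.
  have [->|p0] := eqVneq p 0.
    apply: (@listed_iso _ _ _ _ 0 1 0); last exact: (listed_entry S'_y one0 one0).
    by apply: (kind_scale_const _ t0); rewrite ?et ?mul0r.
  (* The third factor is imposed by [a^2 = bc]; the third coefficient is 0. *)
  have [s s0 es] := inv_sqrt p0.
  apply: (@listed_iso _ _ _ _ 1 1 0); last exact: (listed_entry S'_x_y one0 one0).
  apply: (@kind_scale _ _ s t (s ^+ 2 / t)); rewrite ?et ?es ?mul0r //=.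
    by rewrite mulf_neq0 ?expf_neq0 ?invr_eq0.
  by rewrite !mul1r mulrC divfK.
have [->|q0] := eqVneq q 0; have [->|r0] := eqVneq r 0; rewrite ?orbF ?orbT => nz.
- have [s s0 es] := inv_sqrt nz.
  apply: (@listed_iso _ _ _ _ 1 0 0); last exact: (listed_entry S'_x one0 one0).
  by apply: (kind_scale_const _ s0); rewrite ?es ?mul0r.
- by apply: syz; exact: one_r.
- exact: one_r.
have [t t0 et] := inv_sqrt q0; have [u u0 eu] := inv_sqrt r0.
have [s s0 es] := exists_sqrt (mulf_neq0 t0 u0).
apply: (@listed_iso _ _ _ _ (p * s ^+ 2) 1 1).
  by apply: (kind_scale s0 t0 u0); rewrite /= ?es ?mul0r.
have [->|p0] := eqVneq p 0; first by rewrite mul0r; exact: (listed_entry S'_y_z one0 one0).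
by apply: (listed_entry S'_ax_y_z _ one0); rewrite mulf_neq0 ?expf_neq0.
Qed.

Lemma listed_NC (p q r : k) : [|| p != 0, q != 0 | r != 0] -> listed KindNC p q r.
Proof.
have sxy p' q' r' :=
  listed_iso (@kind_swap_xy k KindNC p' q' r' (fun e => ltac:(discriminate e))).
have [->|r0] := eqVneq r 0; last first.
  move=> _; have [s s0 es] := inv_sqrt r0.
  have s20 : s ^+ 2 != 0 by rewrite expf_neq0.
  apply: (@listed_iso _ _ _ _ (p * s ^+ 2) (q * s ^+ 2) 1).
    by apply: (kind_scale_const _ s0).
  have [->|p0] := eqVneq p 0; have [->|q0] := eqVneq q 0; rewrite ?mul0r.
  - exact: (listed_entry NC_z one0 one0).
  - by apply: sxy; apply: (listed_entry NC_ax_z _ one0); rewrite mulf_neq0.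
  - by apply: (listed_entry NC_ax_z _ one0); rewrite mulf_neq0.
  - by apply: (listed_entry NC_ax_by_z); rewrite mulf_neq0.
have one_p p' : p' != 0 -> listed KindNC p' 0 0.
  move=> p0; have [s s0 es] := inv_sqrt p0.
  apply: (@listed_iso _ _ _ _ 1 0 0); last exact: (listed_entry NC_x one0 one0).
  by apply: (kind_scale_const _ s0); rewrite ?es ?mul0r.
have [->|p0] := eqVneq p 0; have [->|q0] := eqVneq q 0; rewrite ?eqxx //= => _.
- by apply: sxy; exact: one_p.
- exact: one_p.
have [s s0 es] := inv_sqrt q0.
apply: (@listed_iso _ _ _ _ (p * s ^+ 2) 1 0).
  by apply: (kind_scale_const _ s0); rewrite ?mul0r.
by apply: (listed_entry NC_ax_y _ one0); rewrite mulf_neq0 ?expf_neq0.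
Qed.

Lemma listed_all t (p q r : k) : [|| p != 0, q != 0 | r != 0] -> listed t p q r.
Proof. by case: t; [exact: listed_S | exact: listed_S' | exact: listed_NC]. Qed.

Hypothesis two_neq0 : (2%:R : k) != 0.

(** Which coefficients of an entry are nonzero, for nonzero parameters. *)
Definition entry_support (e : entry) : bool * bool * bool :=
  match e with
  | S_x => (true, false, false) | S_x_y => (true, true, false)
  | S_x_y_z => (true, true, true)
  | S'_x => (true, false, false) | S'_y => (false, true, false)
  | S'_x_y => (true, true, false)
  | S'_y_z => (false, true, true) | S'_ax_y_z => (true, true, true)
  | NC_x => (true, false, false) | NC_z => (false, false, true)
  | NC_ax_y => (true, true, false)
  | NC_ax_z => (true, false, true) | NC_ax_by_z => (true, true, true)
  end.

Lemma entry_supportE e (a b : k) : a != 0 -> b != 0 -> let c := entry_coef e a b in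
  entry_support e = (c.1.1 != 0, c.1.2 != 0, c.2 != 0).
Proof. by move=> a0 b0; case: e; rewrite /= ?a0 ?b0 ?oner_neq0 ?eqxx. Qed.

(** The sets of nonzero coefficients agree up to the permutations of the
    generators that are allowed in type [t]. *)
Definition same_support t (s s' : bool * bool * bool) : bool :=
  match t with
  | KindS => (s'.1.1 + s'.1.2 + s'.2 == s.1.1 + s.1.2 + s.2)%N
  | KindS' => (s'.1.1 == s.1.1) && (s'.1.2 + s'.2 == s.1.2 + s.2)%N
  | KindNC => (s'.2 == s.2) && (s'.1.1 + s'.1.2 == s.1.1 + s.1.2)%N
  end.

Lemma kind_iso_support t (p q r p' q' r' : k) :
  kind_iso t p q r p' q' r' ->
  same_support t (p != 0, q != 0, r != 0) (p' != 0, q' != 0, r' != 0).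
Proof.
have nzM (u v : k) : v != 0 -> (u * v ^+ 2 != 0) = (u != 0).
  by move=> v0; rewrite mulf_eq0 sqrf_eq0 (negbTE v0) orbF.
case: t => iso.
- by apply/eqP; exact: (kind_pair_iso_S two_neq0 ((kind_isoP _ _ _ _ _ _ _).1 iso)).
- have [a [b [c [[a0 b0 c0 _] [] [-> -> ->]]]]] :=
    kind_pair_iso_S' two_neq0 ((kind_isoP _ _ _ _ _ _ _).1 iso);
    by rewrite /same_support !nzM //= eqxx ?eqxx // addnC eqxx.
- have [a [b [c [[a0 b0 c0] [_ [] [-> -> ->]]]]]] :=
    kind_pair_iso_NC two_neq0 ((kind_isoP _ _ _ _ _ _ _).1 iso);
    by rewrite /same_support !nzM //= eqxx ?eqxx // addnC eqxx.
Qed.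

Lemma entries_not_iso e e' : e <> e' -> forall a b a' b' : k,
  a != 0 -> b != 0 -> a' != 0 -> b' != 0 ->
  ~ pair_iso (entry_pair e a b) (entry_pair e' a' b').
Proof.
move=> ne a b a' b' a0 b0 a0' b0'; rewrite !entry_pairE => iso.
have ek := kind_pair_iso_kind two_neq0 iso; rewrite -ek in iso.
have := kind_iso_support ((kind_isoP _ _ _ _ _ _ _).2 iso).
rewrite -(entry_supportE e a0 b0) -(entry_supportE e' a0' b0').
by case: e ne ek {iso} => ne; case: e' ne => ne; move=> // _.
Qed.

Lemma iso_S'_ax_y_z (a a' : k) : a != 0 -> a' != 0 ->
  pair_iso (entry_pair S'_ax_y_z a 1) (entry_pair S'_ax_y_z a' 1) <-> a' ^+ 2 = a ^+ 2.
Proof.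
move=> a0 a0'; rewrite !entry_pairE -kind_isoP /=; split=> [iso|e].
  have [s [b [c [[s0 b0 c0 es] [] [-> eb ec]]]]] :=
    kind_pair_iso_S' two_neq0 ((kind_isoP _ _ _ _ _ _ _).1 iso);
    by rewrite es !exprMn -[b ^+ 2]mul1r -[c ^+ 2]mul1r -eb -ec !mulr1.
(* Here [c = a' / a] is a square root of 1; the diagonal map [(s, 1, c)] with
   [s^2 = c] does it. *)
pose c := a' / a; have c0 : c != 0 by rewrite mulf_neq0 ?invr_eq0.
have ec : c ^+ 2 = 1 by rewrite expr_div_n e mulfV ?expf_neq0.
have [s s0 es] := exists_sqrt c0.
apply: (@kind_scale _ _ s 1 c); rewrite /= ?oner_neq0 ?mul0r ?expr1n ?ec ?mul1r ?es //.
by rewrite /c mulrC divfK.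
Qed.

(** The diagonal automorphisms of type NC are [c] times a diagonal matrix of
    cube roots of unity. *)
Lemma NC_scale_cube (a b c : k) : c != 0 -> a ^+ 2 = b * c -> b ^+ 2 = a * c -> a != 0 ->
  [/\ a ^+ 3 = c ^+ 3, b ^+ 3 = c ^+ 3 & a * b = c ^+ 2].
Proof.
move=> c0 ea eb a0.
have eab : a * b = c ^+ 2.
  have b0 : b != 0 by apply: contra_neq a0 => b0; apply/eqP; rewrite -sqrf_eq0 ea b0 mul0r.
  apply: (mulfI (mulf_neq0 a0 b0)).
  by rewrite -expr2 exprMn ea eb; ring.
split=> //; first by rewrite exprS ea mulrA eab -exprSr.
by rewrite [b ^+ 3]exprS eb mulrA [b * a]mulrC eab -exprSr.
Qed.

Lemma NC_cube_scale (a a' : k) : a != 0 -> a' ^+ 3 = a ^+ 3 ->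
  exists2 w, w != 0 & w ^+ 3 = 1 /\ a' = a * w.
Proof.
move=> a0 e; have w3 : (a' / a) ^+ 3 = 1 by rewrite expr_div_n e mulfV ?expf_neq0.
exists (a' / a); last by rewrite w3 mulrC divfK.
by apply/eqP => w0; move/eqP: w3; rewrite w0 expr0n eq_sym oner_eq0.
Qed.

(** The diagonal map with entries [(w^2, w, 1)], where [w^3 = 1]. *)
Lemma NC_root_scale (w p q r p' q' r' : k) : w != 0 -> w ^+ 3 = 1 ->
  p' = p * w -> q' = q * w ^+ 2 -> r' = r ->
  kind_iso KindNC p q r p' q' r'.
Proof.
move=> w0 w3 -> -> ->; have w4 : w ^+ 2 ^+ 2 = w by rewrite -exprM exprS w3 mulr1.
apply: (@kind_scale _ _ (w ^+ 2) w 1); rewrite ?expf_neq0 ?oner_neq0 //= ?w4 ?expr1n ?mulr1 //.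
Qed.

Lemma iso_NC_ax_z (a a' : k) : a != 0 -> a' != 0 ->
  pair_iso (entry_pair NC_ax_z a 1) (entry_pair NC_ax_z a' 1) <-> a' ^+ 3 = a ^+ 3.
Proof.
move=> a0 a0'; rewrite !entry_pairE -kind_isoP /=; split=> [iso|e].
  have [s [b [c [[s0 b0 c0] [[es eb] []]]]]] :=
    kind_pair_iso_NC two_neq0 ((kind_isoP _ _ _ _ _ _ _).1 iso); last first.
    by case=> e; rewrite e mul0r eqxx in a0'.
  case=> -> _; rewrite mul1r => ec.
  have [s3 _ _] := NC_scale_cube c0 es eb s0.
  by rewrite exprMn -exprM mulnC exprM s3 -exprM mulnC exprM -ec expr1n mulr1.
have [w w0 [w3 ->]] := NC_cube_scale a0 e.
by apply: (NC_root_scale w0 w3); rewrite ?mul0r.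
Qed.

Lemma iso_NC_ax_y (a a' : k) : a != 0 -> a' != 0 ->
  pair_iso (entry_pair NC_ax_y a 1) (entry_pair NC_ax_y a' 1) <->
  a' ^+ 3 = a ^+ 3 \/ a' ^+ 3 = a ^- 3.
Proof.
move=> a0 a0'; rewrite !entry_pairE -kind_isoP /=.
have half (u u' : k) : u != 0 -> u' ^+ 3 = u ^+ 3 ->
    kind_iso KindNC u 1 0 u' 1 0.
  move=> u0 e; have [w w0 [w3 ->]] := NC_cube_scale u0 e.
  apply: (@kind_scale _ _ (w ^+ 2) 1 w); rewrite ?expf_neq0 ?oner_neq0 //= ?mul1r ?mul0r ?expr1n //.
  - by rewrite -exprM exprS w3 mulr1.
  - by rewrite -exprSr w3.
  - by rewrite -exprM exprS w3 mulr1.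
split=> [iso|[e|e]].
- have [s [b [c [[s0 b0 c0] [[es eb] []]]]]] :=
    kind_pair_iso_NC two_neq0 ((kind_isoP _ _ _ _ _ _ _).1 iso);
    have [s3 b3 _] := NC_scale_cube c0 es eb s0;
    have s6 : (s ^+ 2) ^+ 3 = (b ^+ 2) ^+ 3 by rewrite -!exprM mulnC !exprM s3 b3.
    by case=> -> + _; rewrite mul1r => e; left; rewrite exprMn s6 -e expr1n mulr1.
  case=> -> e _; right; rewrite mul1r s6.
  have -> : b ^+ 2 = a^-1 by rewrite -[LHS](mulKf a0) -e mulr1.
  by rewrite exprVn.
- exact: half.
(* Exchange [x] and [y], then rescale: the parameter becomes [a^-1]. *)
- apply: (@kind_iso_trans _ _ _ _ _ 1 a 0); first exact: kind_swap_xy.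
  have [s s0 es] := inv_sqrt a0.
  apply: (@kind_iso_trans _ _ _ _ _ a^-1 1 0).
    apply: (kind_scale_const _ s0); rewrite ?mul0r ?es // mul1r.
    by rewrite -[RHS](mulKf a0) es mulr1.
  by apply: half; rewrite ?invr_eq0 // exprVn.
Qed.

Lemma iso_NC_ax_by_z (a b a' b' : k) : a != 0 -> b != 0 -> a' != 0 -> b' != 0 ->
  pair_iso (entry_pair NC_ax_by_z a b) (entry_pair NC_ax_by_z a' b') <->
  (a' ^+ 3, b' ^+ 3, a' * b') = (a ^+ 3, b ^+ 3, a * b)
  \/ (a' ^+ 3, b' ^+ 3, a' * b') = (b ^+ 3, a ^+ 3, a * b).
Proof.
move=> a0 b0 a0' b0'; rewrite !entry_pairE -kind_isoP /=.
have half (u v : k) : u != 0 -> v != 0 ->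
    (a' ^+ 3, b' ^+ 3, a' * b') = (u ^+ 3, v ^+ 3, u * v) ->
    kind_iso KindNC u v 1 a' b' 1.
  move=> u0 v0 [e3 _ e]; have [w w0 [w3 ew]] := NC_cube_scale u0 e3.
  apply: (NC_root_scale w0 w3) => //.
  apply: (mulfI (mulf_neq0 u0 w0)); rewrite -ew e ew.
  by rewrite -[RHS]mulrA [w * _]mulrCA -exprS w3 mulr1.
split=> [iso|[e|e]].
- have [s [t [c [[s0 t0 c0] [[es et] iso']]]]] :=
    kind_pair_iso_NC two_neq0 ((kind_isoP _ _ _ _ _ _ _).1 iso).
  have [s3 t3 st] := NC_scale_cube c0 es et s0.
  have c2 : c ^+ 2 = 1 by case: iso' => -[_ _ ->]; rewrite mul1r.
  have s6 : (s ^+ 2) ^+ 3 = 1 by rewrite -exprM mulnC exprM s3 -exprM mulnC exprM c2 expr1n.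
  have t6 : (t ^+ 2) ^+ 3 = 1 by rewrite -exprM mulnC exprM t3 -exprM mulnC exprM c2 expr1n.
  have st2 : s ^+ 2 * t ^+ 2 = 1 by rewrite -exprMn st c2 expr1n.
  case: iso' => -[-> -> _]; [left | right].
    by rewrite [(a * _) ^+ 3]exprMn s6 [(b * _) ^+ 3]exprMn t6 mulrACA st2 !mulr1.
  by rewrite [(b * _) ^+ 3]exprMn s6 [(a * _) ^+ 3]exprMn t6 mulrACA st2 !mulr1 [b * a]mulrC.
- exact: half.
- apply: (@kind_iso_trans _ _ _ _ _ b a 1); first exact: kind_swap_xy.
  by apply: half; rewrite // e [a * b]mulrC.
Qed.

End Classification.

Theorem theorem4p7 (k : closedFieldType) (chark : [pchar k] =i pred0) :
  (forall (e : entry) (a b : k), a != 0 -> b != 0 ->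
     central_regular_pair (entry_pair e a b))
  /\
  (forall P : algPair k, central_regular_pair P ->
     exists (e : entry) (a b : k),
       [/\ a != 0, b != 0 & pair_iso P (entry_pair e a b)])
  /\
  (forall e e' : entry, e <> e' -> forall a b a' b' : k,
     a != 0 -> b != 0 -> a' != 0 -> b' != 0 ->
     ~ pair_iso (entry_pair e a b) (entry_pair e' a' b'))
  /\
  (forall a a' : k, a != 0 -> a' != 0 ->
     pair_iso (qpair (R := algS' k) (fun x y z => a *: x ^+ 2 + y ^+ 2 + z ^+ 2))
              (qpair (R := algS' k) (fun x y z => a' *: x ^+ 2 + y ^+ 2 + z ^+ 2))
     <-> a' ^+ 2 = a ^+ 2)
  /\
  (forall a a' : k, a != 0 -> a' != 0 ->
     pair_iso (qpair (R := algNC k) (fun x y z => a *: x ^+ 2 + y ^+ 2))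
              (qpair (R := algNC k) (fun x y z => a' *: x ^+ 2 + y ^+ 2))
     <-> a' ^+ 3 = a ^+ 3 \/ a' ^+ 3 = a ^- 3)
  /\
  (forall a a' : k, a != 0 -> a' != 0 ->
     pair_iso (qpair (R := algNC k) (fun x y z => a *: x ^+ 2 + z ^+ 2))
              (qpair (R := algNC k) (fun x y z => a' *: x ^+ 2 + z ^+ 2))
     <-> a' ^+ 3 = a ^+ 3)
  /\
  (forall a b a' b' : k, a != 0 -> b != 0 -> a' != 0 -> b' != 0 ->
     pair_iso
       (qpair (R := algNC k) (fun x y z => a *: x ^+ 2 + b *: y ^+ 2 + z ^+ 2))
       (qpair (R := algNC k) (fun x y z => a' *: x ^+ 2 + b' *: y ^+ 2 + z ^+ 2))
     <-> (a' ^+ 3, b' ^+ 3, a' * b') = (a ^+ 3, b ^+ 3, a * b)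
         \/ (a' ^+ 3, b' ^+ 3, a' * b') = (b ^+ 3, a ^+ 3, a * b)).
Proof.
have two_neq0 : (2%:R : k) != 0.
  by rewrite natf_neq0_pchar; apply/pnatP => // p _ _; rewrite inE /= chark.
split=> [e a b a0 b0|].
  by rewrite entry_pairE; apply: kind_pair_central_regular; exact: entry_coef_neq0.
split=> [P /(central_regular_pair_kind two_neq0)[t [p [q [r [nz iso]]]]]|].
  have [e [a [b [a0 b0 et /kind_isoP iso']]]] := listed_all t nz.
  exists e, a, b; split; [exact: a0 | exact: b0 |].
  by rewrite entry_pairE et; exact: pair_iso_trans iso iso'.
split; first exact: entries_not_iso two_neq0.
split; first exact: iso_S'_ax_y_z two_neq0.
split; first exact: iso_NC_ax_y two_neq0.
split; first exact: iso_NC_ax_z two_neq0.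
exact: iso_NC_ax_by_z two_neq0.
Qed.
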